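(* Let $\mathcal K$ be an essentially small tensor triangulated category with tensor unit $\mathbf 1$ and graded central ring $R=\bigoplus_{i\in\mathbb Z}\mathrm{Hom}_{\mathcal K}(\mathbf 1,\Sigma^i\mathbf 1)$. Assume: (a) $\mathrm{Thick}(\mathbf 1)=\mathcal K$; (b) $R$ is a (graded) noetherian ring concentrated in even degrees and, for every homogeneous prime ideal $\mathfrak p$ of $R$, the maximal ideal $\mathfrak pR_{\mathfrak p}$ of the local ring $R_{\mathfrak p}$ is generated by a (finite) regular sequence of homogeneous non-zero-divisors. Then there is an inclusion-preserving bijection between the thick subcategories $\mathcal C$ of $\mathcal K$ and the specialization closed subsets $V$ of $\mathrm{Spec}\,R$. It maps a thick subcategory $\mathcal C$ to $V=\bigcup_{X\in\mathcal C}\mathrm{Supp}_R H^*X$, and its inverse maps a specialization closed subset $V$ to $\mathcal C=\{X\in\mathcal K\mid \mathrm{Supp}_R H^*X\subseteq V\}$.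
   Context: A tensor triangulated category is a triangulated category $\mathcal K$ (suspension $\Sigma$) with a symmetric monoidal structure $\otimes$, unit $\mathbf 1$, exact in each variable. Thick subcategory: full triangulated subcategory closed under direct summands; $\mathrm{Thick}(\mathbf 1)$ is the smallest one containing $\mathbf 1$. $R$ is a graded commutative ring (up to a sign $\epsilon\in R^0$, $\epsilon^2=1$). $\mathrm{Spec}\,R$ is the set of homogeneous prime ideals with the Zariski topology; $R_{\mathfrak p}$, $M_{\mathfrak p}$ denote graded localization, inverting the homogeneous elements of $R\smallsetminus\mathfrak p$. In (b), the generators $f_1,\dots,f_n$ of $\mathfrak pR_{\mathfrak p}$ are homogeneous, each $f_i$ is a non-zero-divisor in $R_{\mathfrak p}$ and in $R_{\mathfrak p}/(f_1,\dots,f_{i-1})$. $H^*X:=\bigoplus_{i}\mathrm{Hom}_{\mathcal K}(\mathbf 1,\Sigma^iX)$ as a graded $R$-module, and $\mathrm{Supp}_RM:=\{\mathfrak p\in\mathrm{Spec}\,R\mid M_{\mathfrak p}\neq0\}$ for a graded $R$-module $M$. A subset $V\subseteq\mathrm{Spec}\,R$ is specialization closed if $\mathfrak p\in V$ and $\mathfrak p\subseteq\mathfrak q$ imply $\mathfrak q\in V$. *)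

(* Defs.v *)
From mathcomp Require Import all_boot all_order all_algebra.
From mathcomp Require Import classical_sets.

Set Implicit Arguments.
Unset Strict Implicit.
Unset Printing Implicit Defensive.

Import GRing.Theory.
Local Open Scope ring_scope.

Declare Scope cat_scope.
Delimit Scope cat_scope with cat.
Local Open Scope cat_scope.

Record preadditive := Preadditive {
  ob :> Type;
  mor : ob -> ob -> zmodType;
  idm : forall X, mor X X;
  ccomp : forall {X Y Z}, mor Y Z -> mor X Y -> mor X Z;
  ccomp_idl : forall X Y (f : mor X Y), ccomp (idm Y) f = f;
  ccomp_idr : forall X Y (f : mor X Y), ccomp f (idm X) = f;
  ccompA : forall X Y Z W (h : mor Z W) (g : mor Y Z) (f : mor X Y),
    ccomp h (ccomp g f) = ccomp (ccomp h g) f;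
  ccompDl : forall X Y Z (g g' : mor Y Z) (f : mor X Y),
    ccomp (g + g') f = ccomp g f + ccomp g' f;
  ccompDr : forall X Y Z (g : mor Y Z) (f f' : mor X Y),
    ccomp g (f + f') = ccomp g f + ccomp g f'
}.

Arguments mor {p} X Y.
Arguments idm {p} X.
Arguments ccomp {p X Y Z} g f.

Notation "g \c f" := (ccomp g f) (at level 40, left associativity) : cat_scope.

Definition is_iso (K : preadditive) (X Y : K) (f : mor X Y) : Prop :=
  exists g : mor Y X, g \c f = idm X /\ f \c g = idm Y.

Definition isomorphic (K : preadditive) (X Y : K) : Prop :=
  exists f : mor X Y, is_iso f.

Definition is_zero (K : preadditive) (Z : K) : Prop := idm Z = 0.

(* W is a direct sum of X and Y. *)
Definition is_biproduct (K : preadditive) (X Y W : K) : Prop :=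
  exists (i1 : mor X W) (i2 : mor Y W) (p1 : mor W X) (p2 : mor W Y),
    [/\ p1 \c i1 = idm X, p2 \c i2 = idm Y, p2 \c i1 = 0, p1 \c i2 = 0
      & i1 \c p1 + i2 \c p2 = idm W].

(* The isomorphism classes of objects form a set.  Types of morphisms and
   choiceTypes play the role of sets; objects live in an independent universe. *)
Definition essentially_small (K : preadditive) : Prop :=
  exists (S : choiceType) (F : S -> K), forall X : K, exists s, isomorphic X (F s).

(* The suspension is an auto-equivalence Sigma together with a choice of all its
   powers: [sh n] is Sigma^n, with coherent natural isomorphisms
   X ~ Sigma^0 X and Sigma^j (Sigma^i X) ~ Sigma^(i + j) X, i.e. a monoidal
   functor from the discrete category of integers to the endofunctors of K.
   [shD] takes the value of i + j up to a proof, which avoids transports. *)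

Record shift_category := ShiftCategory {
  sh_base :> preadditive;
  sh : int -> sh_base -> sh_base;
  shm : forall (n : int) {X Y}, mor X Y -> mor (sh n X) (sh n Y);
  shm_id : forall n X, shm n (idm X) = idm (sh n X);
  shm_comp : forall n X Y Z (g : mor Y Z) (f : mor X Y),
    shm n (g \c f) = shm n g \c shm n f;
  shm_add : forall n X Y (f g : mor X Y), shm n (f + g) = shm n f + shm n g;

  sh0 : forall X, mor X (sh 0 X);
  sh0_iso : forall X, is_iso (sh0 X);
  sh0_nat : forall X Y (f : mor X Y), sh0 Y \c f = shm 0 f \c sh0 X;

  shD : forall {i j k : int} (e : i + j = k) X, mor (sh j (sh i X)) (sh k X);
  shD_iso : forall i j k (e : i + j = k) X, is_iso (shD e X);
  shD_nat : forall i j k (e : i + j = k) X Y (f : mor X Y),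
    shD e Y \c shm j (shm i f) = shm k f \c shD e X;

  shD0l : forall j (e : 0 + j = j) X, shD e X \c shm j (sh0 X) = idm (sh j X);
  shD0r : forall i (e : i + 0 = i) X, shD e X \c sh0 (sh i X) = idm (sh i X);
  shDA : forall i j k ij jk n (e1 : i + j = ij) (e2 : ij + k = n)
      (e3 : j + k = jk) (e4 : i + jk = n) X,
    shD e2 X \c shm k (shD e1 X) = shD e4 X \c shD e3 (sh i X)
}.

Arguments sh {s} n X.
Arguments shm {s} n {X Y} f.
Arguments sh0 {s} X.
Arguments shD {s i j k} e X.

Notation Sg := (sh 1).
Notation Sgm := (shm 1).

Record triangulated := Triangulated {
  tri_base :> shift_category;
  zero_ex : exists Z : tri_base, is_zero Z;
  biproduct_ex : forall X Y : tri_base, exists W, is_biproduct X Y W;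

  (* [dist f g h]: the triangle X -f-> Y -g-> Z -h-> Sigma X is exact. *)
  dist : forall {X Y Z : tri_base}, mor X Y -> mor Y Z -> mor Z (Sg X) -> Prop;

  (* TR1 *)
  dist_iso : forall X Y Z (f : mor X Y) (g : mor Y Z) (h : mor Z (Sg X))
      X' Y' Z' (f' : mor X' Y') (g' : mor Y' Z') (h' : mor Z' (Sg X'))
      (a : mor X X') (b : mor Y Y') (c : mor Z Z'),
    is_iso a -> is_iso b -> is_iso c ->
    b \c f = f' \c a -> c \c g = g' \c b -> Sgm a \c h = h' \c c ->
    dist f g h -> dist f' g' h';
  dist_id : forall X Z : tri_base, is_zero Z ->
    dist (idm X) (0 : mor X Z) (0 : mor Z (Sg X));
  dist_cone : forall (X Y : tri_base) (f : mor X Y),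
    exists Z (g : mor Y Z) (h : mor Z (Sg X)), dist f g h;
  (* TR2 *)
  dist_rot : forall X Y Z (f : mor X Y) (g : mor Y Z) (h : mor Z (Sg X)),
    dist f g h <-> dist g h (- Sgm f);
  (* TR3 *)
  dist_mor : forall X Y Z (f : mor X Y) (g : mor Y Z) (h : mor Z (Sg X))
      X' Y' Z' (f' : mor X' Y') (g' : mor Y' Z') (h' : mor Z' (Sg X'))
      (a : mor X X') (b : mor Y Y'),
    dist f g h -> dist f' g' h' -> b \c f = f' \c a ->
    exists c : mor Z Z', c \c g = g' \c b /\ Sgm a \c h = h' \c c;
  (* TR4, the octahedral axiom *)
  dist_oct : forall (X Y Z : tri_base) (u : mor X Y) (v : mor Y Z)
      Z' (i : mor Y Z') (i' : mor Z' (Sg X))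
      X' (j : mor Z X') (j' : mor X' (Sg Y))
      Y' (k : mor Z Y') (k' : mor Y' (Sg X)),
    dist u i i' -> dist v j j' -> dist (v \c u) k k' ->
    exists (f : mor Z' Y') (g : mor Y' X'),
      [/\ f \c i = k \c v, k' \c f = i', g \c k = j, j' \c g = Sgm u \c k'
        & dist f g (Sgm i \c j')]
}.

Arguments dist {t X Y Z} f g h.

Record tt_category := TTCategory {
  tt_base :> triangulated;

  tens : tt_base -> tt_base -> tt_base;
  tensm : forall {X X' Y Y'},
    mor X X' -> mor Y Y' -> mor (tens X Y) (tens X' Y');
  tensm_id : forall X Y, tensm (idm X) (idm Y) = idm (tens X Y);
  tensm_comp : forall X X' X'' Y Y' Y'' (f' : mor X' X'') (f : mor X X')
      (g' : mor Y' Y'') (g : mor Y Y'),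
    tensm (f' \c f) (g' \c g) = tensm f' g' \c tensm f g;
  tensmDl : forall X X' Y Y' (f f' : mor X X') (g : mor Y Y'),
    tensm (f + f') g = tensm f g + tensm f' g;
  tensmDr : forall X X' Y Y' (f : mor X X') (g g' : mor Y Y'),
    tensm f (g + g') = tensm f g + tensm f g';

  tunit : tt_base;
  tassoc : forall X Y Z, mor (tens (tens X Y) Z) (tens X (tens Y Z));
  tlunit : forall X, mor (tens tunit X) X;
  trunit : forall X, mor (tens X tunit) X;
  tsym : forall X Y, mor (tens X Y) (tens Y X);
  tassoc_iso : forall X Y Z, is_iso (tassoc X Y Z);
  tlunit_iso : forall X, is_iso (tlunit X);
  trunit_iso : forall X, is_iso (trunit X);
  tassoc_nat : forall X X' Y Y' Z Z' (f : mor X X') (g : mor Y Y') (h : mor Z Z'),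
    tassoc X' Y' Z' \c tensm (tensm f g) h = tensm f (tensm g h) \c tassoc X Y Z;
  tlunit_nat : forall X X' (f : mor X X'),
    tlunit X' \c tensm (idm tunit) f = f \c tlunit X;
  trunit_nat : forall X X' (f : mor X X'),
    trunit X' \c tensm f (idm tunit) = f \c trunit X;
  tsym_nat : forall X X' Y Y' (f : mor X X') (g : mor Y Y'),
    tsym X' Y' \c tensm f g = tensm g f \c tsym X Y;
  tpentagon : forall X Y Z W,
    tassoc X Y (tens Z W) \c tassoc (tens X Y) Z W =
    tensm (idm X) (tassoc Y Z W)
      \c (tassoc X (tens Y Z) W \c tensm (tassoc X Y Z) (idm W));
  ttriangle : forall X Y,
    tensm (idm X) (tlunit Y) \c tassoc X tunit Y = tensm (trunit X) (idm Y);
  thexagon : forall X Y Z,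
    tassoc Y Z X \c (tsym X (tens Y Z) \c tassoc X Y Z) =
    tensm (idm Y) (tsym X Z) \c (tassoc Y X Z \c tensm (tsym X Y) (idm Z));
  tsymK : forall X Y, tsym Y X \c tsym X Y = idm (tens X Y);

  (* [tshl] and [tshr] turn - (x) Y and X (x) - into exact functors; no
     compatibility between the two is required. *)
  tshl : forall X Y, mor (tens (Sg X) Y) (Sg (tens X Y));
  tshl_iso : forall X Y, is_iso (tshl X Y);
  tshl_nat : forall X X' Y Y' (f : mor X X') (g : mor Y Y'),
    tshl X' Y' \c tensm (Sgm f) g = Sgm (tensm f g) \c tshl X Y;
  tens_exactl : forall X Y Z (f : mor X Y) (g : mor Y Z) (h : mor Z (Sg X)) W,
    dist f g h ->
    dist (tensm f (idm W)) (tensm g (idm W)) (tshl X W \c tensm h (idm W));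
  tshr : forall X Y, mor (tens X (Sg Y)) (Sg (tens X Y));
  tshr_iso : forall X Y, is_iso (tshr X Y);
  tshr_nat : forall X X' Y Y' (f : mor X X') (g : mor Y Y'),
    tshr X' Y' \c tensm f (Sgm g) = Sgm (tensm f g) \c tshr X Y;
  tens_exactr : forall X Y Z (f : mor X Y) (g : mor Y Z) (h : mor Z (Sg X)) W,
    dist f g h ->
    dist (tensm (idm W) f) (tensm (idm W) g) (tshr W X \c tensm (idm W) h)
}.

Arguments tunit {t}.

(* A full subcategory is given by its class of objects. *)
Record thick (K : triangulated) (C : K -> Prop) : Prop := Thick {
  thick_zero : forall X, is_zero X -> C X;
  thick_sh : forall n X, C X -> C (sh n X);
  thick_cone : forall X Y Z (f : mor X Y) (g : mor Y Z) (h : mor Z (Sg X)),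
    dist f g h -> C X -> C Y -> C Z;
  thick_summand : forall X Y W, is_biproduct X Y W -> C W -> C X
}.

Definition thick_gen (K : triangulated) (X : K) : K -> Prop :=
  fun Y => forall C, thick C -> C X -> C Y.

(* A graded object is the family of its homogeneous components.  Commutativity
   (up to a sign) of a graded ring is not part of the structure; ideals are
   two-sided and modules are right modules.  The graded endomorphism ring of the
   unit of a tensor triangulated category is graded commutative up to a sign by
   the Eckmann-Hilton argument. *)

Record gring := GradedRing {
  gr :> int -> zmodType;
  gone : gr 0;
  gmul : forall {i j k : int}, i + j = k -> gr i -> gr j -> gr k;
  gmulDl : forall i j k (e : i + j = k) (a a' : gr i) (b : gr j),
    gmul e (a + a') b = gmul e a b + gmul e a' b;
  gmulDr : forall i j k (e : i + j = k) (a : gr i) (b b' : gr j),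
    gmul e a (b + b') = gmul e a b + gmul e a b';
  gmul1l : forall i (e : 0 + i = i) (a : gr i), gmul e gone a = a;
  gmul1r : forall i (e : i + 0 = i) (a : gr i), gmul e a gone = a;
  gmulA : forall i j k ij jk n (e1 : i + j = ij) (e2 : ij + k = n)
      (e3 : j + k = jk) (e4 : i + jk = n) (a : gr i) (b : gr j) (c : gr k),
    gmul e2 (gmul e1 a b) c = gmul e4 a (gmul e3 b c)
}.

Arguments gone {g}.
Arguments gmul {g i j k} e a b.

Record gmodule (R : gring) := GradedModule {
  gm :> int -> zmodType;
  gact : forall {i j k : int}, i + j = k -> gm i -> R j -> gm k;
  gactDl : forall i j k (e : i + j = k) (m m' : gm i) (a : R j),
    gact e (m + m') a = gact e m a + gact e m' a;
  gactDr : forall i j k (e : i + j = k) (m : gm i) (a a' : R j),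
    gact e m (a + a') = gact e m a + gact e m a';
  gact1 : forall i (e : i + 0 = i) (m : gm i), gact e m gone = m;
  gactA : forall i j k ij jk n (e1 : i + j = ij) (e2 : ij + k = n)
      (e3 : j + k = jk) (e4 : i + jk = n) (m : gm i) (a : R j) (b : R k),
    gact e2 (gact e1 m a) b = gact e4 m (gmul e3 a b)
}.

Arguments gact {R g i j k} e m a.

Definition gregular (R : gring) : gmodule R :=
  GradedModule (@gmulDl R) (@gmulDr R) (@gmul1r R) (@gmulA R).

Definition even_degrees (R : gring) : Prop :=
  forall i (a : R i), odd `|i|%N -> a = 0.

Record is_hideal (R : gring) (I : forall i, set (R i)) : Prop := IsHIdeal {
  hideal0 : forall i, I i 0;
  hidealD : forall i a b, I i a -> I i b -> I i (a + b);
  hidealMl : forall i j k (e : i + j = k) (a : R i) b, I j b -> I k (gmul e a b);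
  hidealMr : forall i j k (e : i + j = k) a (b : R j), I i a -> I k (gmul e a b)
}.

Definition hnoetherian (R : gring) : Prop :=
  forall I : nat -> forall i, set (R i),
    (forall n, is_hideal (I n)) -> (forall n i, (I n i `<=` I n.+1 i)%classic) ->
    exists N, forall n, (N <= n)%N -> forall i, I n i = I N i.

(* The points of Spec R; the coercion gives the homogeneous elements of degree i
   of the prime ideal. *)
Record Spec (R : gring) := HPrime {
  hprime :> forall i, set (R i);
  hprime_ideal : is_hideal hprime;
  hprime1 : ~ @hprime 0 gone;
  hprimeM : forall i j k (e : i + j = k) (a : R i) (b : R j),
    @hprime k (gmul e a b) -> @hprime i a \/ @hprime j b
}.

Definition spec_le (R : gring) (p q : Spec R) : Prop :=
  forall i, (p i `<=` q i)%classic.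

Definition specialization_closed (R : gring) (V : set (Spec R)) : Prop :=
  forall p q, V p -> spec_le p q -> V q.

(* The homogeneous elements of degree d of M_p are the fractions m / s with m
   and s homogeneous, s not in p, and deg m - deg s = d, up to [floc_eq]:
   m / s = m' / s' when m s' u = m' s u for some homogeneous u not in p. *)

Section Localization.
Variables (R : gring) (p : Spec R).

Lemma floc_den_mul i j k (e : i + j = k) (s : R i) (t : R j) :
  ~ p i s -> ~ p j t -> ~ p k (gmul e s t).
Proof. by move=> ps pt /hprimeM[]. Qed.

Arguments floc_den_mul {i j k} e {s t} _ _.

Section Fractions.
Variable M : gmodule R.

Record floc (d : int) := Frac {
  ndeg : int;
  ddeg : int;
  fnum : M ndeg;
  fden : R ddeg;
  fdenP : ~ p ddeg fden;
  fdegE : d + ddeg = ndeg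
}.

Lemma floc_cross d (x y : floc d) : ndeg y + ddeg x = ndeg x + ddeg y.
Proof. by rewrite -!fdegE addrAC. Qed.

Definition floc_eq d (x y : floc d) : Prop :=
  exists (i : int) (u : R i), ~ p i u /\
    gact erefl (gact erefl (fnum x) (fden y)) u =
    gact erefl (gact (floc_cross x y) (fnum y) (fden x)) u.

Definition floc_of d (m : M d) : floc d :=
  Frac m (@hprime1 R p) (addr0 d).

Lemma floc_add_deg d (x y : floc d) :
  d + (ddeg x + ddeg y) = ndeg x + ddeg y.
Proof. by rewrite addrA fdegE. Qed.

Definition floc_add d (x y : floc d) : floc d :=
  Frac (gact erefl (fnum x) (fden y) +
        gact (floc_cross x y) (fnum y) (fden x))
    (floc_den_mul erefl (@fdenP _ x) (@fdenP _ y)) (floc_add_deg x y).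

End Fractions.

Arguments floc_of {M d} m.

Notation rloc := (floc (gregular R)).

Lemma rloc_mul_deg i j k (e : i + j = k) (x : rloc i) (y : rloc j) :
  k + (ddeg x + ddeg y) = ndeg x + ndeg y.
Proof. by rewrite -!fdegE -e addrACA. Qed.

Definition rloc_mul i j k (e : i + j = k) (x : rloc i) (y : rloc j) : rloc k :=
  @Frac (gregular R) k _ _ (gmul erefl (fnum x) (fnum y)) _
    (floc_den_mul erefl (@fdenP _ _ x) (@fdenP _ _ y)) (rloc_mul_deg e x y).

Record is_rloc_ideal (J : forall d, set (rloc d)) : Prop := IsRlocIdeal {
  rloc_ideal_eq : forall d (x y : rloc d), floc_eq x y -> J d x -> J d y;
  rloc_ideal0 : forall d, J d (floc_of 0);
  rloc_idealD : forall d x y, J d x -> J d y -> J d (floc_add x y);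
  rloc_idealMl : forall i j k (e : i + j = k) (x : rloc i) y,
    J j y -> J k (rloc_mul e x y);
  rloc_idealMr : forall i j k (e : i + j = k) x (y : rloc j),
    J i x -> J k (rloc_mul e x y)
}.

Definition rloc_gen (S : set {d : int & rloc d}) : forall d, set (rloc d) :=
  fun d x => forall J : forall d, set (rloc d),
    is_rloc_ideal J -> (forall y, S y -> J (tag y) (tagged y)) -> J d x.

(* p R_p *)
Definition rloc_max : forall d, set (rloc d) :=
  rloc_gen [set x | exists (d : int) (a : R d),
              p d a /\ x = Tagged (fun d => rloc d) (floc_of (a : gregular R d))]%classic.

(* f is a non-zero-divisor in R_p / J; as f is homogeneous it is enough to test
   homogeneous elements. *)
Definition nonzerodivisor_mod (J : forall d, set (rloc d))
    (f : {d : int & rloc d}) : Prop :=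
  forall i k (e : i + tag f = k) (x : rloc i),
    J k (rloc_mul e x (tagged f)) -> J i x.

Definition nonzerodivisor : {d : int & rloc d} -> Prop :=
  nonzerodivisor_mod (fun d x => floc_eq x (floc_of 0)).

(* Each f_i is a non-zero-divisor both in R_p and in R_p / (f_j : j < i). *)
Definition regular_sequence n (f : 'I_n -> {d : int & rloc d}) : Prop :=
  forall i : 'I_n, nonzerodivisor (f i) /\
    nonzerodivisor_mod
      (rloc_gen [set x | exists j : 'I_n, (j < i)%N /\ x = f j]%classic) (f i).

Definition max_ideal_regular : Prop :=
  exists (n : nat) (f : 'I_n -> {d : int & rloc d}), regular_sequence f /\
    forall d, rloc_max (d := d) = rloc_gen [set f i | i in setT]%classic (d := d).

End Localization.

Definition Supp (R : gring) (M : gmodule R) : set (Spec R) :=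
  [set p | exists (d : int) (x : floc p M d), ~ floc_eq x (floc_of p 0)]%classic.

Section Cohomology.
Variable K : tt_category.
Local Notation one := (@tunit K).

(* m . a is the composite
   1 -a-> Sigma^j 1 -Sigma^j m-> Sigma^j Sigma^i X ~ Sigma^k X. *)
Definition hact (X : K) (i j k : int) (e : i + j = k)
    (m : mor one (sh i X)) (a : mor one (sh j one)) : mor one (sh k X) :=
  shD e X \c (shm j m \c a).

Lemma hactDl X i j k (e : i + j = k) (m m' : mor one (sh i X))
    (a : mor one (sh j one)) :
  hact e (m + m') a = hact e m a + hact e m' a.
Proof. by rewrite /hact shm_add ccompDl ccompDr. Qed.

Lemma hactDr X i j k (e : i + j = k) (m : mor one (sh i X))
    (a a' : mor one (sh j one)) :
  hact e m (a + a') = hact e m a + hact e m a'.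
Proof. by rewrite /hact !ccompDr. Qed.

Lemma hact1 X i (e : i + 0 = i) (m : mor one (sh i X)) :
  hact e m (sh0 one) = m.
Proof. by rewrite /hact -sh0_nat ccompA shD0r ccomp_idl. Qed.

Lemma hact1l i (e : 0 + i = i) (a : mor one (sh i one)) :
  hact e (sh0 one) a = a.
Proof. by rewrite /hact ccompA shD0l ccomp_idl. Qed.

Lemma hactA X i j k ij jk n (e1 : i + j = ij) (e2 : ij + k = n)
    (e3 : j + k = jk) (e4 : i + jk = n) (m : mor one (sh i X))
    (a : mor one (sh j one)) (b : mor one (sh k one)) :
  hact e2 (hact e1 m a) b = hact e4 m (hact e3 a b).
Proof.
rewrite /hact !shm_comp !ccompA (shDA e1 e2 e3 e4).
by rewrite -[_ \c shm jk m \c _]ccompA -shD_nat !ccompA.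
Qed.

Definition central_ring : gring :=
  @GradedRing (fun i => mor one (sh i one)) (sh0 one) (@hact one)
    (@hactDl one) (@hactDr one) hact1l (@hact1 one) (@hactA one).

Definition cohomology (X : K) : gmodule central_ring :=
  @GradedModule central_ring (fun i => mor one (sh i X)) (@hact X)
    (@hactDl X) (@hactDr X) (@hact1 X) (@hactA X).

Definition supp_of (C : K -> Prop) : set (Spec central_ring) :=
  [set p | exists X, C X /\ Supp (cohomology X) p]%classic.

Definition subcat_of (V : set (Spec central_ring)) : K -> Prop :=
  fun X => (Supp (cohomology X) `<=` V)%classic.

End Cohomology.

(* Main.v *)
(** The ring R acts on K by natural maps r : X -> Sigma^d X, namely r (x) X, and
    cone(r) (x) X is the cone of r on X.  As K is generated by the unit, every
    H^*X is noetherian, thick subcategories are tensor ideals, and an object with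
    zero cohomology at p has an identity killed by some s outside p.

    Let C be thick and suppose that some X outside C is supported in the support
    of C.  Among such objects take W with maximal annihilator.  Then
    p = { r | cone(r) (x) W is not in C } = { r | r^2 W = 0 } is a prime in the
    support of W, hence of some Y in C.  Let a_1, ..., a_n be a regular sequence
    generating p at p, and Q = cone(a_1) (x) ... (x) cone(a_n).  The cohomology
    of Q at p is the residue field, and each a_i acts on Q by zero at p: on
    cone(a_i) it factors through an odd class of a module in even degrees.  So a
    class of H^*(Q (x) Y) extends to a map from a suspension of Q, and
    Q (x) Y is at p a finite sum of suspensions of Q, nonzero by Nakayama.  Hence
    some s outside p on Q factors through Q (x) Y, which is in C.  Tensoring with
    W, and since cone(s) (x) Q (x) W is in C, we get Q (x) W in C; but maximality
    of the annihilator keeps Q (x) W outside C, as a_1, ..., a_n are in p.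

    For the surjectivity on subsets, an object W with p in its support and
    maximal annihilator has r^2 W = 0 for r in p, so its support is the closure
    of p. *)

Require Import Defs.
From mathcomp Require Import all_boot all_order all_algebra.
From mathcomp Require Import boolp classical_sets zify.

Set Implicit Arguments.
Unset Strict Implicit.
Unset Printing Implicit Defensive.

Import GRing.Theory.
Local Open Scope ring_scope.
Local Open Scope cat_scope.

(** * Triangulated categories and thick subcategories *)

Section Preadditive.
Variable K : preadditive.
Implicit Types X Y Z W : K.

Lemma comp0r X Y Z (f : mor X Y) : (0 : mor Y Z) \c f = 0.
Proof. by apply: (addrI ((0 : mor Y Z) \c f)); rewrite -ccompDl !addr0. Qed.

Lemma compr0 X Y Z (g : mor Y Z) : g \c (0 : mor X Y) = 0.
Proof. by apply: (addrI (g \c (0 : mor X Y))); rewrite -ccompDr !addr0. Qed.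

Lemma compNl X Y Z (g : mor Y Z) (f : mor X Y) : (- g) \c f = - (g \c f).
Proof. by apply/eqP; rewrite -addr_eq0 -ccompDl addNr comp0r. Qed.

Lemma compNr X Y Z (g : mor Y Z) (f : mor X Y) : g \c (- f) = - (g \c f).
Proof. by apply/eqP; rewrite -addr_eq0 -ccompDr addNr compr0. Qed.

Lemma compBl X Y Z (g g' : mor Y Z) (f : mor X Y) :
  (g - g') \c f = g \c f - g' \c f.
Proof. by rewrite ccompDl compNl. Qed.

Lemma compBr X Y Z (g : mor Y Z) (f f' : mor X Y) :
  g \c (f - f') = g \c f - g \c f'.
Proof. by rewrite ccompDr compNr. Qed.

Lemma iso_id X : is_iso (idm X).
Proof. by exists (idm X); rewrite ccomp_idl. Qed.

Lemma iso_comp X Y Z (g : mor Y Z) (f : mor X Y) :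
  is_iso g -> is_iso f -> is_iso (g \c f).
Proof.
move=> [g' [g'g gg']] [f' [f'f ff']]; exists (f' \c g'); split.
  by rewrite ccompA -[f' \c g' \c g]ccompA g'g ccomp_idr.
by rewrite ccompA -[g \c f \c f']ccompA ff' ccomp_idr.
Qed.

(** The inverse is a total function, with default value 0 off isomorphisms, so that it can stand in
    composites without carrying a proof. *)
Definition isoinv X Y (f : mor X Y) : mor Y X :=
  if pselect (is_iso f) is left h then projT1 (cid h) else 0.

Lemma isoinvl X Y (f : mor X Y) : is_iso f -> isoinv f \c f = idm X.
Proof. by rewrite /isoinv => h; case: pselect => // h'; case: cid => g []. Qed.

Lemma isoinvr X Y (f : mor X Y) : is_iso f -> f \c isoinv f = idm Y.
Proof. by rewrite /isoinv => h; case: pselect => // h'; case: cid => g []. Qed.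

Lemma iso_isoinv X Y (f : mor X Y) : is_iso f -> is_iso (isoinv f).
Proof. by move=> h; exists f; rewrite isoinvl ?isoinvr. Qed.

Lemma isoKl X Y Z (f : mor X Y) (g : mor Z X) : is_iso f -> isoinv f \c (f \c g) = g.
Proof. by move=> h; rewrite ccompA isoinvl ?ccomp_idl. Qed.

Lemma isoKVl X Y Z (f : mor X Y) (g : mor Z Y) : is_iso f -> f \c (isoinv f \c g) = g.
Proof. by move=> h; rewrite ccompA isoinvr ?ccomp_idl. Qed.

Lemma isoKr X Y Z (f : mor X Y) (g : mor Y Z) : is_iso f -> g \c f \c isoinv f = g.
Proof. by move=> h; rewrite -ccompA isoinvr ?ccomp_idr. Qed.

Lemma isoKVr X Y Z (f : mor X Y) (g : mor X Z) : is_iso f -> g \c isoinv f \c f = g.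
Proof. by move=> h; rewrite -ccompA isoinvl ?ccomp_idr. Qed.

Lemma iso_monic X Y Z (f : mor X Y) (g h : mor Z X) :
  is_iso f -> f \c g = f \c h -> g = h.
Proof. by move=> i e; rewrite -(isoKl g i) e isoKl. Qed.

Lemma iso_epic X Y Z (f : mor X Y) (g h : mor Y Z) :
  is_iso f -> g \c f = h \c f -> g = h.
Proof. by move=> i e; rewrite -(isoKr g i) e isoKr. Qed.

Lemma iso_compl0 X Y Z (f : mor X Y) (g : mor Z X) :
  is_iso f -> f \c g = 0 -> g = 0.
Proof. by move=> i e; apply: (iso_monic i); rewrite e compr0. Qed.

Lemma iso_compr0 X Y Z (f : mor X Y) (g : mor Y Z) :
  is_iso f -> g \c f = 0 -> g = 0.
Proof. by move=> i e; apply: (iso_epic i); rewrite e comp0r. Qed.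

Lemma isoinv_nat X Y X' Y' (u : mor X Y) (v : mor X' Y') (f : mor X X') (g : mor Y Y') :
  is_iso u -> is_iso v -> g \c u = v \c f -> f \c isoinv u = isoinv v \c g.
Proof.
move=> iu iv e; apply: (iso_monic iv); rewrite isoKVl //.
by rewrite ccompA -e isoKr.
Qed.

Lemma isomorphic_sym X Y : isomorphic X Y -> isomorphic Y X.
Proof. by move=> [f i]; exists (isoinv f); apply: iso_isoinv. Qed.

Lemma isomorphic_trans Y X Z : isomorphic X Y -> isomorphic Y Z -> isomorphic X Z.
Proof. by move=> [f i] [g j]; exists (g \c f); apply: iso_comp. Qed.

Lemma zero_from X Y (f : mor X Y) : is_zero X -> f = 0.
Proof. by move=> z; rewrite -[f]ccomp_idr z compr0. Qed.

Lemma zero_to X Y (f : mor X Y) : is_zero Y -> f = 0.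
Proof. by move=> z; rewrite -[f]ccomp_idl z comp0r. Qed.

End Preadditive.

(** * Powers of the suspension as equivalences *)

Section Shift.
Variable K : shift_category.
Implicit Types X Y Z W : K.

Lemma shm_iso n X Y (f : mor X Y) : is_iso f -> is_iso (shm n f).
Proof.
move=> i; exists (shm n (isoinv f)).
by rewrite -!shm_comp isoinvl // isoinvr // !shm_id.
Qed.

Lemma shm0 n X Y : shm n (0 : mor X Y) = 0.
Proof. by apply: (addrI (shm n (0 : mor X Y))); rewrite -shm_add !addr0. Qed.

Lemma shmN n X Y (f : mor X Y) : shm n (- f) = - shm n f.
Proof. by apply/eqP; rewrite -addr_eq0 -shm_add addNr shm0. Qed.

Lemma shm_isoinv n X Y (f : mor X Y) : is_iso f -> shm n (isoinv f) = isoinv (shm n f).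
Proof.
move=> i; apply: (iso_epic (shm_iso n i)).
by rewrite -shm_comp !isoinvl ?shm_id //; apply: shm_iso.
Qed.

Definition shV i j (e : i + j = 0) X : mor X (sh j (sh i X)) :=
  isoinv (shD e X) \c sh0 X.

Lemma shV_iso i j (e : i + j = 0) X : is_iso (shV e X).
Proof. by apply: iso_comp (sh0_iso X); apply/iso_isoinv/shD_iso. Qed.

Lemma shV_nat i j (e : i + j = 0) X Y (f : mor X Y) :
  shV e Y \c f = shm j (shm i f) \c shV e X.
Proof.
rewrite /shV -ccompA sh0_nat !ccompA; congr (_ \c _).
by rewrite -[RHS](isoKl _ (shD_iso e Y)) [shD e Y \c _]ccompA shD_nat isoKr //; apply: shD_iso.
Qed.

Lemma shm_inj n X Y (f g : mor X Y) : shm n f = shm n g -> f = g.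
Proof.
move=> e; apply: (iso_monic (shV_iso (subrr n) Y)).
by rewrite !shV_nat e.
Qed.

Lemma shm_eq0 n X Y (f : mor X Y) : shm n f = 0 -> f = 0.
Proof. by move=> e; apply: (@shm_inj n); rewrite shm0. Qed.

(** The usual proof that an equivalence is full: f is conjugated by the unit [shV], and faithfulness
    of Sigma^(-n) identifies the result. *)
Lemma shm_full n X Y (f : mor (sh n X) (sh n Y)) : exists g, f = shm n g.
Proof.
pose g := isoinv (shV (subrr n) Y) \c (shm (- n) f \c shV (subrr n) X).
exists g; apply: (@shm_inj (- n)); apply: (iso_epic (shV_iso (subrr n) X)).
by rewrite -shV_nat isoKVl //; apply: shV_iso.
Qed.

(** The adjunction between Sigma^m and Sigma^n for m + n = 0: [g] is the transpose of [f]. *)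
Lemma shm_fullV m n (e : m + n = 0) W Y (f : mor W (sh n Y)) :
  exists g : mor (sh m W) Y, f = shm n g \c shV e W.
Proof.
have [g fg] := shm_full (f \c isoinv (shV e W)); exists g.
by rewrite -fg isoKVr //; apply: shV_iso.
Qed.

Lemma shm_fullV' m n (e : m + n = 0) W Y (f : mor (sh n W) Y) :
  exists g : mor W (sh m Y), f = isoinv (shV e Y) \c shm n g.
Proof.
have [g fg] := shm_full (shV e Y \c f); exists g.
by rewrite -fg isoKl //; apply: shV_iso.
Qed.

Lemma sh_zero n X : is_zero X -> is_zero (sh n X).
Proof. by move=> z; rewrite /is_zero -shm_id z shm0. Qed.

Lemma sh_isomorphic n X Y : isomorphic X Y -> isomorphic (sh n X) (sh n Y).
Proof. by move=> [f i]; exists (shm n f); apply: shm_iso. Qed.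

(* Composites such as this one are locked so that rewriting with [ccompA] does
   not unfold them. *)
Definition unsh d X : mor (sh d (sh (- d) X)) X :=
  locked (isoinv (sh0 X) \c shD (addNr d) X).

Lemma unshE d X : unsh d X = isoinv (sh0 X) \c shD (addNr d) X.
Proof. by rewrite /unsh -lock. Qed.

Lemma unsh_iso d X : is_iso (unsh d X).
Proof. by rewrite unshE; apply: iso_comp (shD_iso _ _); apply/iso_isoinv/sh0_iso. Qed.

Lemma unsh_nat d X Y (f : mor X Y) :
  f \c unsh d X = unsh d Y \c shm d (shm (- d) f).
Proof.
rewrite !unshE -ccompA shD_nat !ccompA; congr (_ \c _).
by apply: isoinv_nat; rewrite ?sh0_nat //; apply: sh0_iso.
Qed.

Lemma shm_unsh d j X (dj : int) (e1 : d + j = dj) (e2 : - d + dj = j) :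
  shm j (unsh d X) = shD e2 X \c shD e1 (sh (- d) X).
Proof.
have e0 : 0 + j = j by rewrite add0r.
rewrite unshE shm_comp -(shDA (addNr d) e0 e1 e2) shm_isoinv; last exact: sh0_iso.
congr (_ \c _); apply: (iso_epic (shm_iso j (sh0_iso X))).
by rewrite isoinvl ?shD0l //; apply/shm_iso/sh0_iso.
Qed.

End Shift.

(** * Exact triangles: long exact sequences and uniqueness of cones *)

Section Triangulated.
Variable K : triangulated.
Implicit Types X Y Z W : K.

Section Exactness.
Variables (X Y Z : K) (f : mor X Y) (g : mor Y Z) (h : mor Z (Sg X)).
Hypothesis d : dist f g h.

(** The pair (id, f) maps the triangle of the identity of X to the given one, and the third
    component starts at a zero object. *)
Lemma dist_comp0 : g \c f = 0.
Proof.
have [O zO] := zero_ex K.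
have [|c [c1 _]] := dist_mor (a := idm X) (b := f) (dist_id X zO) d.
  by [].
by rewrite -c1 compr0.
Qed.

Lemma dist_rot1 : dist g h (- Sgm f).
Proof. exact: (proj1 (dist_rot _ _ _) d). Qed.

Lemma dist_rot2 : dist h (- Sgm f) (- Sgm g).
Proof. exact: (proj1 (dist_rot _ _ _) dist_rot1). Qed.

End Exactness.

(** TR3 is applied to W -> 0 -> Sigma W and the rotated triangle; the map Sigma W -> Sigma X it
    yields is a suspension by fullness. *)
Lemma dist_lift X Y Z (f : mor X Y) (g : mor Y Z) (h : mor Z (Sg X)) W (m : mor W Y) :
  dist f g h -> g \c m = 0 -> exists n, m = f \c n.
Proof.
move=> d m0; have [O zO] := zero_ex K.
have d1 := dist_rot1 (dist_id W zO).
have [|c [_]] := dist_mor (a := m) (b := 0) d1 (dist_rot1 d).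
  by rewrite m0 compr0.
have [n ->] := shm_full c.
rewrite shm_id compNl compNr ccomp_idr -shm_comp => /oppr_inj e.
by exists n; apply: shm_inj e.
Qed.

Lemma dist_Sg_comp0 X Y Z (f : mor X Y) (g : mor Y Z) (h : mor Z (Sg X)) :
  dist f g h -> Sgm f \c h = 0.
Proof.
move=> /dist_rot2/dist_comp0; rewrite compNl => /eqP.
by rewrite oppr_eq0 => /eqP.
Qed.

Lemma dist_lift' X Y Z (f : mor X Y) (g : mor Y Z) (h : mor Z (Sg X)) W (m : mor W Z) :
  dist f g h -> h \c m = 0 -> exists n, m = g \c n.
Proof. by move=> /dist_rot1; apply: dist_lift. Qed.

Lemma dist_lift'' X Y Z (f : mor X Y) (g : mor Y Z) (h : mor Z (Sg X)) W (m : mor W (Sg X)) :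
  dist f g h -> Sgm f \c m = 0 -> exists n, m = h \c n.
Proof.
by move=> /dist_rot2 d e; apply: (dist_lift d); rewrite compNl e oppr0.
Qed.

Lemma dist_ext X Y Z (f : mor X Y) (g : mor Y Z) (h : mor Z (Sg X)) W (m : mor Y W) :
  dist f g h -> m \c f = 0 -> exists n, m = n \c g.
Proof.
move=> d m0; have [O zO] := zero_ex K.
have zO' : is_zero (sh (-1) O) by apply: sh_zero.
(* The triangle 0 -> W = W -> 0, obtained by rotating that of the identity. *)
have d' : dist (0 : mor (sh (-1) O) W) (idm W) (0 : mor W (Sg (sh (-1) O))).
  apply: (proj2 (dist_rot _ _ _)); rewrite shm0 oppr0.
  apply: (dist_iso (a := idm W) (b := idm W) (c := 0) _ _ _ _ _ _ (dist_id W zO)).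
  - exact: iso_id.
  - exact: iso_id.
  - by exists 0; rewrite compr0 zO comp0r (sh_zero 1 zO').
  - by [].
  - by rewrite !comp0r.
  - by rewrite shm_id compr0 comp0r.
have [|n [n1 _]] := dist_mor (a := 0) (b := m) d d'.
  by rewrite m0 comp0r.
by exists n; rewrite n1 ccomp_idl.
Qed.

Lemma dist_ext' X Y Z (f : mor X Y) (g : mor Y Z) (h : mor Z (Sg X)) W (m : mor Z W) :
  dist f g h -> m \c g = 0 -> exists n, m = n \c h.
Proof. by move=> /dist_rot1; apply: dist_ext. Qed.

Lemma shm_dist_lift j X Y Z (f : mor X Y) (g : mor Y Z) (h : mor Z (Sg X)) W
    (m : mor W (sh j Y)) :
  dist f g h -> shm j g \c m = 0 -> exists n, m = shm j f \c n.
Proof.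
move=> d; have [m' ->] := shm_fullV (addNr j) m.
rewrite ccompA -shm_comp => /(iso_compr0 (shV_iso _ _))/shm_eq0/(dist_lift d)[n ->].
by exists (shm j n \c shV (addNr j) W); rewrite shm_comp ccompA.
Qed.

Lemma shm_dist_lift' j X Y Z (f : mor X Y) (g : mor Y Z) (h : mor Z (Sg X)) W
    (m : mor W (sh j Z)) :
  dist f g h -> shm j h \c m = 0 -> exists n, m = shm j g \c n.
Proof. by move=> /dist_rot1; apply: shm_dist_lift. Qed.

Lemma shm_dist_ext j X Y Z (f : mor X Y) (g : mor Y Z) (h : mor Z (Sg X)) W
    (m : mor (sh j Y) W) :
  dist f g h -> m \c shm j f = 0 -> exists n, m = n \c shm j g.
Proof.
move=> d; have [m' ->] := shm_fullV' (addNr j) m.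
rewrite -ccompA -shm_comp.
move=> /(iso_compl0 (iso_isoinv (shV_iso _ _)))/shm_eq0/(dist_ext d)[n ->].
by exists (isoinv (shV (addNr j) W) \c shm j n); rewrite shm_comp ccompA.
Qed.

Lemma shm_dist_ext' j X Y Z (f : mor X Y) (g : mor Y Z) (h : mor Z (Sg X)) W
    (m : mor (sh j Z) W) :
  dist f g h -> m \c shm j g = 0 -> exists n, m = n \c shm j h.
Proof. by move=> /dist_rot1; apply: shm_dist_ext. Qed.

(** A five lemma by hand: the comparison map [c] of TR3 is left cancellable, and a right inverse is
    a lift of h' corrected by a map through Y. *)
Lemma cone_unique X Y Z Z' (f : mor X Y) (g : mor Y Z) (h : mor Z (Sg X))
    (g' : mor Y Z') (h' : mor Z' (Sg X)) :
  dist f g h -> dist f g' h' -> isomorphic Z Z'.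
Proof.
move=> d d'.
have [|c [cg hc]] := dist_mor (a := idm X) (b := idm Y) d d'.
  by rewrite ccomp_idl ccomp_idr.
rewrite ccomp_idr in cg; rewrite shm_id ccomp_idl in hc.
have inj W (n : mor W Z) : c \c n = 0 -> n = 0.
  move=> cn; have [|y yE] := dist_lift' (m := n) d.
    by rewrite hc -ccompA cn compr0.
  have [|x xE] := dist_lift (m := y) d'.
    by rewrite -cg -ccompA -yE.
  by rewrite yE xE ccompA (dist_comp0 d) comp0r.
have [|n nE] := dist_lift'' (m := h') d; first exact: dist_Sg_comp0 d'.
have [|y yE] := dist_lift' (m := idm Z' - c \c n) d'.
  by rewrite compBr ccompA -hc -nE ccomp_idr subrr.
have cD : c \c (n + g \c y) = idm Z'.
  by rewrite ccompDr ccompA cg -yE addrC subrK.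
exists c; exists (n + g \c y); split=> //; apply/eqP; rewrite -subr_eq0; apply/eqP.
by apply: inj; rewrite compBr ccompA cD ccomp_idl ccomp_idr subrr.
Qed.

(** As i is a split monomorphism, the connecting map of its cone vanishes, so the projection g to
    the cone has a section t. *)
Lemma retract_summand X W (i : mor X W) (r : mor W X) :
  r \c i = idm X -> exists Y, is_biproduct X Y W.
Proof.
move=> ri; have [Y [g [h d]]] := dist_cone i; exists Y.
have h0 : h = 0.
  by rewrite -[h]ccomp_idl -shm_id -ri shm_comp -ccompA (dist_Sg_comp0 d) compr0.
have [|t tE] := dist_lift' (m := idm Y) d; first by rewrite h0 comp0r.
have gi := dist_comp0 d.
(* The section t is corrected so that r kills it. *)
exists i, (t - i \c (r \c t)), r, g; split=> //.
- by rewrite compBr !ccompA gi !comp0r subr0 -tE.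
- by rewrite compBr ccompA ri ccomp_idl subrr.
have [|n nE] := dist_lift (m := idm W - (i \c r + (t - i \c (r \c t)) \c g)) d.
  rewrite compBr ccomp_idr ccompDr !ccompA gi comp0r add0r.
  by rewrite compBr !ccompA -tE gi !comp0r subr0 ccomp_idl subrr.
have n0 : n = 0.
  rewrite -[n]ccomp_idl -ri -ccompA -nE compBr ccompDr ccomp_idr !ccompA ri.
  by rewrite compBr !ccompA ri !ccomp_idl subrr comp0r addr0 subrr.
by move/eqP: nE; rewrite n0 compr0 subr_eq0 => /eqP.
Qed.

End Triangulated.

(** * Thick subcategories and morphisms with cone in them *)

Section Thick.
Variables (K : triangulated) (C : K -> Prop).
Hypothesis tC : thick C.
Implicit Types X Y Z W : K.

Lemma thick_retract X W (i : mor X W) (r : mor W X) : r \c i = idm X -> C W -> C X.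
Proof. by move=> /retract_summand[Y b]; apply: thick_summand b. Qed.

Lemma thick_iso X Y : isomorphic X Y -> C X -> C Y.
Proof.
by move=> [f i]; apply: thick_retract (isoinv f) f (isoinvr i).
Qed.

Lemma thick_unsh n X : C (sh n X) -> C X.
Proof.
move=> /(thick_sh tC (- n)); apply: thick_iso; apply: isomorphic_sym.
by exists (shV (subrr n) X); apply: shV_iso.
Qed.

Lemma thick_cone2 X Y Z (f : mor X Y) (g : mor Y Z) (h : mor Z (Sg X)) :
  dist f g h -> C X -> C Z -> C Y.
Proof.
move=> /dist_rot2 d CX CZ; apply: (@thick_unsh 1); apply: thick_cone d _ _ => //.
exact: thick_sh.
Qed.

(** These are the morphisms that become invertible in the Verdier quotient by C. *)
Definition cone_in X Y (f : mor X Y) :=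
  exists Z (g : mor Y Z) (h : mor Z (Sg X)), dist f g h /\ C Z.

Lemma cone_inP X Y (f : mor X Y) Z (g : mor Y Z) (h : mor Z (Sg X)) :
  dist f g h -> cone_in f -> C Z.
Proof. by move=> d [Z' [g' [h' [d' ]]]]; apply: thick_iso; apply: cone_unique d' d. Qed.

Lemma cone_in_iso X Y X' Y' (f : mor X Y) (f' : mor X' Y') (a : mor X X') (b : mor Y Y') :
  is_iso a -> is_iso b -> b \c f = f' \c a -> cone_in f -> cone_in f'.
Proof.
move=> ia ib e [Z [g [h [d CZ]]]].
exists Z, (g \c isoinv b), (Sgm a \c h); split=> //.
apply: (dist_iso (c := idm Z) ia ib (iso_id Z) e _ _ d).
  by rewrite ccomp_idl isoKVr.
by rewrite ccomp_idr.
Qed.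

Lemma cone_in_compl X Y Y' (f : mor X Y) (b : mor Y Y') :
  is_iso b -> cone_in (b \c f) <-> cone_in f.
Proof.
move=> ib; split.
  apply: (cone_in_iso (iso_id X) (iso_isoinv ib)).
  by rewrite isoKl // ccomp_idr.
by apply: (cone_in_iso (iso_id X) ib); rewrite ccomp_idr.
Qed.

Lemma cone_in_compr X X' Y (f : mor X Y) (a : mor X' X) :
  is_iso a -> cone_in (f \c a) <-> cone_in f.
Proof.
move=> ia; split.
  by apply: (cone_in_iso ia (iso_id Y)); rewrite ccomp_idl.
apply: (cone_in_iso (iso_isoinv ia) (iso_id Y)).
by rewrite ccomp_idl isoKr.
Qed.

Lemma cone_in_Sg X Y (f : mor X Y) : cone_in (Sgm f) <-> cone_in f.
Proof.
have [Z [g [h d]]] := dist_cone f.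
(* Three rotations negate all three maps; the isomorphism (-1, 1, -1) removes the first two
   signs. *)
have d3 : dist (Sgm f) (Sgm g) (- Sgm h).
  apply: (dist_iso (a := - idm _) (b := idm _) (c := - idm _) _ _ _ _ _ _
           (dist_rot1 (dist_rot2 d))).
  - by exists (- idm _); rewrite compNl compNr ccomp_idl opprK.
  - exact: iso_id.
  - by exists (- idm _); rewrite compNl compNr ccomp_idl opprK.
  - by rewrite ccomp_idl compNr ccomp_idr.
  - by rewrite compNl compNr ccomp_idl ccomp_idr opprK.
  - by rewrite shmN shm_id !compNl !compNr ccomp_idl ccomp_idr.
split=> [/(cone_inP d3) CZ|/(cone_inP d) CZ].
  by exists Z, g, h; split=> //; apply: thick_unsh CZ.
by exists (Sg Z), (Sgm g), (- Sgm h); split=> //; apply: thick_sh.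
Qed.

Lemma cone_in_shD i j X Y (f : mor X Y) :
  cone_in (shm j (shm i f)) <-> cone_in (shm (i + j) f).
Proof.
rewrite -(cone_in_compl _ (shD_iso erefl Y)) shD_nat.
by rewrite (cone_in_compr _ (shD_iso _ _)).
Qed.

Lemma cone_in_sh n X Y (f : mor X Y) : cone_in (shm n f) <-> cone_in f.
Proof.
elim/int_ind: n X Y f => [|n IH|n IH] X Y f.
- rewrite -(cone_in_compr _ (sh0_iso X)) -sh0_nat.
  exact: cone_in_compl (sh0_iso Y).
- by rewrite -addn1 PoszD -cone_in_shD cone_in_Sg.
have e : - n.+1%:Z + 1 = - n%:Z by rewrite -addn1 PoszD opprD addrK.
by rewrite -cone_in_Sg cone_in_shD e.
Qed.

Lemma cone_in_comp X Y Z (f : mor X Y) (g : mor Y Z) :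
  cone_in f -> cone_in g -> cone_in (g \c f).
Proof.
move=> [Z' [i [i' [d CZ']]]] [X' [j [j' [d' CX']]]].
have [Y' [k [k' d'']]] := dist_cone (g \c f).
have [u [v [_ _ _ _ dd]]] := dist_oct d d' d''.
by exists Y', k, k'; split=> //; apply: thick_cone2 dd CZ' CX'.
Qed.

(** The cone Q of the inclusion of X in X + B is a retract of B: p2 factors through Q, and i2
    followed by W -> Q is a retraction. *)
Lemma cone_in_biproduct X B W (i1 : mor X W) (i2 : mor B W) (p1 : mor W X) (p2 : mor W B) :
  p1 \c i1 = idm X -> p2 \c i2 = idm B -> p2 \c i1 = 0 ->
  i1 \c p1 + i2 \c p2 = idm W -> C B -> cone_in i1.
Proof.
move=> e1 e2 e3 e4 CB; have [Q [g [h d]]] := dist_cone i1.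
exists Q, g, h; split=> //.
have gi := dist_comp0 d.
have h0 : h = 0.
  by rewrite -[h]ccomp_idl -shm_id -e1 shm_comp -ccompA (dist_Sg_comp0 d) compr0.
have [n nE] := dist_ext d e3.
apply: (thick_retract (i := n) (r := g \c i2)) CB.
apply/eqP; rewrite -subr_eq0; apply/eqP.
have [|t ->] := dist_ext' (m := g \c i2 \c n - idm Q) d.
  rewrite compBl -ccompA -nE -ccompA ccomp_idl.
  have -> : i2 \c p2 = idm W - i1 \c p1 by rewrite -e4 [i1 \c _ + _]addrC addrK.
  by rewrite compBr ccomp_idr ccompA gi comp0r subr0 subrr.
by rewrite h0 compr0.
Qed.

(* In the Verdier quotient by C the morphism [b \c a] is both zero and
   invertible.  Without the quotient: the map (b a, b) : A + B -> A' has its cone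
   in C, and it is isomorphic to (0, b), whose cone has Sg A as a summand. *)
Lemma thick_of_factor A B A' (a : mor A B) (b : mor B A') :
  C B -> cone_in (b \c a) -> C A.
Proof.
move=> CB cba.
have [W [i1 [i2 [p1 [p2 [e11 e22 e21 e12 eW]]]]]] := biproduct_ex A B.
have [N [q [n d]]] := dist_cone (b \c a \c p1 + b \c p2).
have ci1 := cone_in_biproduct e11 e22 e21 eW CB.
(* Restricted along i1, the map (b a, b) is b a; the octahedron then places its cone in a triangle
   with those of i1 and b a. *)
have ci2 : cone_in (b \c a \c p1 + b \c p2).
  exists N, q, n; split=> //.
  have [Z' [i [i' [d1 CZ']]]] := ci1.
  have e : (b \c a \c p1 + b \c p2) \c i1 = b \c a.
    by rewrite ccompDl -!ccompA e11 e21 !compr0 addr0 ccomp_idr.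
  have [Y' [k [k' [d3 CY']]]] := cba.
  rewrite -e in d3.
  have [u [v [_ _ _ _ dd]]] := dist_oct d1 d d3.
  exact: thick_cone dd CZ' CY'.
have CN := cone_inP d ci2.
apply: (@thick_unsh 1).
(* The map (b a, b) kills psi = (1, - a), so Sigma psi lifts to N, and Sigma p1 after n splits the
   lift. *)
pose psi := i1 - i2 \c a.
have [|l lE] := dist_lift'' (m := Sgm psi) d.
  rewrite -shm_comp /psi; apply/eqP/eqP.
  rewrite compBr !ccompDl -!ccompA [p1 \c (i2 \c a)]ccompA [p2 \c (i2 \c a)]ccompA.
  by rewrite e11 e21 e12 e22 comp0r !compr0 ccomp_idr ccomp_idl addr0 add0r subrr shm0.
apply: (thick_retract (i := l) (r := Sgm p1 \c n)) CN.
rewrite -ccompA -lE -shm_comp /psi compBr ccompA e11 e12 comp0r subr0.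
exact: shm_id.
Qed.

End Thick.

(** * The central action of the graded endomorphism ring of the unit *)

Section Squares.
Variable K : preadditive.

(** Squares are pasted here, inverted by [sq_inv], suspended by [sq_shm] and tensored by [sq_tens],
    so that naturality of a long composite is checked factor by factor. *)
Lemma sq_comp (X Y Z X' Y' Z' : K) (v : mor X Y) (w : mor Y Z) (v' : mor X' Y')
    (w' : mor Y' Z') (f : mor X X') (g : mor Y Y') (h : mor Z Z') :
  v' \c f = g \c v -> w' \c g = h \c w -> w' \c v' \c f = h \c (w \c v).
Proof. by move=> e1 e2; rewrite -ccompA e1 !ccompA e2. Qed.

Lemma sq_inv (X Y X' Y' : K) (v : mor X Y) (v' : mor X' Y') (f : mor X X') (g : mor Y Y') :
  is_iso v -> is_iso v' -> v' \c f = g \c v -> isoinv v' \c g = f \c isoinv v.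
Proof. by move=> i i' e; rewrite (isoinv_nat i i' (esym e)). Qed.

End Squares.

Lemma sq_shm (K : shift_category) n (X Y X' Y' : K) (v : mor X Y) (v' : mor X' Y')
    (f : mor X X') (g : mor Y Y') :
  v' \c f = g \c v -> shm n v' \c shm n f = shm n g \c shm n v.
Proof. by move=> e; rewrite -!shm_comp e. Qed.

Section Tensor.
Variable K : tt_category.
Implicit Types A B X Y Z W : K.
Local Notation one := (@tunit K).

Lemma sq_tens (X Y X' Y' A B A' B' : K) (v : mor X Y) (v' : mor X' Y')
    (f : mor X X') (g : mor Y Y') (w : mor A B) (w' : mor A' B')
    (h : mor A A') (k : mor B B') :
  v' \c f = g \c v -> w' \c h = k \c w ->
  tensm v' w' \c tensm f h = tensm g k \c tensm v w.
Proof. by move=> e1 e2; rewrite -!tensm_comp e1 e2. Qed.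

Lemma tensm_iso X X' Y Y' (f : mor X X') (g : mor Y Y') :
  is_iso f -> is_iso g -> is_iso (tensm f g).
Proof.
move=> i j; exists (tensm (isoinv f) (isoinv g)).
by rewrite -!tensm_comp !isoinvl // !isoinvr // !tensm_id.
Qed.

Lemma tensm0l X X' Y Y' (g : mor Y Y') : tensm (0 : mor X X') g = 0.
Proof. by apply: (addrI (tensm (0 : mor X X') g)); rewrite -tensmDl !addr0. Qed.

Lemma tensm0r X X' Y Y' (f : mor X X') : tensm f (0 : mor Y Y') = 0.
Proof. by apply: (addrI (tensm f (0 : mor Y Y'))); rewrite -tensmDr !addr0. Qed.

Lemma tsym_iso X Y : is_iso (tsym X Y).
Proof. by exists (tsym Y X); rewrite !tsymK. Qed.

(* The left unitor, corrected by an automorphism of the unit so as to agree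
   with the right one on the unit; this avoids the proof that it does anyway. *)
Definition lun X : mor (tens one X) X :=
  locked (tlunit X \c tensm (trunit one \c isoinv (tlunit one)) (idm X)).

Lemma lunE X : lun X = tlunit X \c tensm (trunit one \c isoinv (tlunit one)) (idm X).
Proof. by rewrite /lun -lock. Qed.

Lemma lun_iso X : is_iso (lun X).
Proof.
rewrite lunE; apply: (iso_comp (tlunit_iso X)); apply: tensm_iso (iso_id X).
by apply: iso_comp (trunit_iso _) _; apply/iso_isoinv/tlunit_iso.
Qed.

Lemma lun_nat X Y (f : mor X Y) : lun Y \c tensm (idm one) f = f \c lun X.
Proof.
rewrite !lunE; apply: sq_comp (tlunit_nat f).
by rewrite -!tensm_comp !ccomp_idl !ccomp_idr.
Qed.

(** With l and r the unitors at the unit, naturality of r turns w (x) 1 into r^-1 w r; for w = r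
    l^-1 everything cancels to r. *)
Lemma lun_unit : lun one = trunit one.
Proof.
rewrite lunE; set w := _ \c isoinv _.
have -> : tensm w (idm one) = isoinv (trunit one) \c (w \c trunit one).
  by rewrite -trunit_nat isoKl //; apply: trunit_iso.
rewrite /w; set l := tlunit one; set r := trunit one.
have il : is_iso l by apply: tlunit_iso.
have ir : is_iso r by apply: trunit_iso.
by rewrite -[r \c _ \c r]ccompA isoKl // isoKVl.
Qed.

Definition sh_tens_nat j (t : forall A X, mor (tens A (sh j X)) (sh j (tens A X))) :=
  (forall A X, is_iso (t A X)) /\
  (forall A A' X X' (f : mor A A') (g : mor X X'),
     t A' X' \c tensm f (shm j g) = shm j (tensm f g) \c t A X).

Lemma sh_tens_nat0 : exists t, sh_tens_nat (j := 0) t.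
Proof.
exists (fun A X => sh0 (tens A X) \c tensm (idm A) (isoinv (sh0 X))); split=> [A X|A A' X X' f g].
  by apply: iso_comp (sh0_iso _) (tensm_iso (iso_id _) (iso_isoinv (sh0_iso _))).
apply: sq_comp (sh0_nat _); apply: sq_tens.
  by rewrite ccomp_idl ccomp_idr.
by apply: sq_inv (sh0_nat g); apply: sh0_iso.
Qed.

Lemma sh_tens_natD i j (t : forall A X, mor (tens A (sh i X)) (sh i (tens A X)))
    (s : forall A X, mor (tens A (sh j X)) (sh j (tens A X))) :
  sh_tens_nat t -> sh_tens_nat s -> exists r, sh_tens_nat (j := i + j) r.
Proof.
move=> [it nt] [js ns].
exists (fun A X => shD erefl _ \c (shm j (t A X) \c
   (s A (sh i X) \c tensm (idm A) (isoinv (shD erefl X))))); split=> [A X|A A' X X' f g].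
  apply: iso_comp (shD_iso _ _) _; apply: iso_comp (shm_iso _ (it _ _)) _.
  apply: iso_comp (js _ _) (tensm_iso (iso_id _) (iso_isoinv (shD_iso _ _))).
apply: sq_comp (shD_nat _ _); apply: sq_comp (sq_shm _ (nt _ _ _ _ _ _)).
apply: sq_comp (ns _ _ _ _ _ _); apply: sq_tens.
  by rewrite ccomp_idl ccomp_idr.
by apply: sq_inv (shD_nat _ g); apply: shD_iso.
Qed.

(** The inverse of t at Sigma^(-j) X, desuspended j times, gives the isomorphism for - j. *)
Lemma sh_tens_natN j (t : forall A X, mor (tens A (sh j X)) (sh j (tens A X))) :
  sh_tens_nat t -> exists r, sh_tens_nat (j := - j) r.
Proof.
move=> [it nt].
exists (fun A X => shm (- j) (tensm (idm A) (unsh j X)) \c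
  (shm (- j) (isoinv (t A (sh (- j) X))) \c shV (subrr j) _)); split=> [A X|A A' X X' f g].
  apply: iso_comp (shm_iso _ (tensm_iso (iso_id _) (unsh_iso _ _))) _.
  exact: iso_comp (shm_iso _ (iso_isoinv (it _ _))) (shV_iso _ _).
apply: sq_comp; first apply: sq_comp (shV_nat _ _) _.
- by apply: sq_shm; apply: sq_inv (nt _ _ _ _ _ _).
apply: sq_shm; apply: sq_tens.
  by rewrite ccomp_idl ccomp_idr.
by rewrite unsh_nat.
Qed.

Lemma sh_tens_nat_ex j : exists t, sh_tens_nat (j := j) t.
Proof.
have pos (n : nat) : exists t, sh_tens_nat (j := n%:Z) t.
  elim: n => [|n [t tP]]; first exact: sh_tens_nat0.
  rewrite -addn1 PoszD; apply: (sh_tens_natD (j := 1) (s := @tshr K) tP).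
  by split=> *; [apply: tshr_iso | apply: tshr_nat].
case: j => n; first exact: pos.
by rewrite NegzE; have [t tP] := pos n.+1; apply: sh_tens_natN tP.
Qed.

(** The failure [psi] of compatibility with the left unitor is a natural automorphism of Sigma^j;
    composing t with its inverse removes it. *)
Lemma tsh_ex j : exists t, sh_tens_nat (j := j) t /\
  forall X, shm j (lun X) \c t one X = lun (sh j X).
Proof.
have [t [it nt]] := sh_tens_nat_ex j.
pose psi X := shm j (lun X) \c (t one X \c isoinv (lun (sh j X))).
have ipsi X : is_iso (psi X).
  apply: iso_comp (shm_iso _ (lun_iso _)) _; apply: iso_comp (it _ _) _.
  exact: iso_isoinv (lun_iso _).
have npsi X Y (f : mor X Y) : psi Y \c shm j f = shm j f \c psi X.
  apply: sq_comp (sq_shm _ (lun_nat f)); apply: sq_comp (nt _ _ _ _ _ _).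
  exact: sq_inv (lun_iso _) (lun_iso _) (lun_nat _).
exists (fun A X => t A X \c tensm (idm A) (isoinv (psi X))); split; first split.
- by move=> A X; apply: iso_comp (it _ _) (tensm_iso (iso_id _) (iso_isoinv _)).
- move=> A A' X X' f g; apply: sq_comp (nt _ _ _ _ _ _); apply: sq_tens.
    by rewrite ccomp_idl ccomp_idr.
  exact: sq_inv.
move=> X; have e : shm j (lun X) \c t one X = psi X \c lun (sh j X).
  by rewrite /psi -!ccompA isoinvl ?ccomp_idr //; apply: lun_iso.
by rewrite ccompA e -ccompA lun_nat ccompA isoinvr // ccomp_idl.
Qed.

(** The symmetry moves the suspension to the left factor; the failure [th] of compatibility with the
    right unitor is then removed in the same way. *)
Lemma lsh_ex j : exists l : forall A X, mor (tens (sh j A) X) (sh j (tens A X)),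
  [/\ forall A X, is_iso (l A X),
      forall A A' X X' (f : mor A A') (g : mor X X'),
        l A' X' \c tensm (shm j f) g = shm j (tensm f g) \c l A X
    & forall A, shm j (trunit A) \c l A one = trunit (sh j A)].
Proof.
have [t [it nt]] := sh_tens_nat_ex j.
pose l0 A X := shm j (tsym X A) \c (t X A \c tsym (sh j A) X).
have il0 A X : is_iso (l0 A X).
  exact: iso_comp (shm_iso _ (tsym_iso _ _)) (iso_comp (it _ _) (tsym_iso _ _)).
have nl0 A A' X X' (f : mor A A') (g : mor X X') :
    l0 A' X' \c tensm (shm j f) g = shm j (tensm f g) \c l0 A X.
  apply: sq_comp (sq_shm _ (tsym_nat _ _)).
  exact: sq_comp (tsym_nat _ _) (nt _ _ _ _ _ _).
pose th A := shm j (trunit A) \c (l0 A one \c isoinv (trunit (sh j A))).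
have ith A : is_iso (th A).
  apply: iso_comp (shm_iso _ (trunit_iso _)) (iso_comp (il0 _ _) _).
  exact: iso_isoinv (trunit_iso _).
have nth A A' (f : mor A A') : th A' \c shm j f = shm j f \c th A.
  apply: sq_comp (sq_shm _ (trunit_nat f)); apply: sq_comp (nl0 _ _ _ _ _ _).
  exact: sq_inv (trunit_iso _) (trunit_iso _) (trunit_nat _).
exists (fun A X => l0 A X \c tensm (isoinv (th A)) (idm X)); split.
- by move=> A X; apply: iso_comp (il0 _ _) (tensm_iso (iso_isoinv _) (iso_id _)).
- move=> A A' X X' f g; apply: sq_comp (nl0 _ _ _ _ _ _); apply: sq_tens.
    exact: sq_inv.
  by rewrite ccomp_idl ccomp_idr.
move=> A; have e : shm j (trunit A) \c l0 A one = th A \c trunit (sh j A).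
  by rewrite /th -!ccompA isoinvl ?ccomp_idr //; apply: trunit_iso.
by rewrite ccompA e -ccompA trunit_nat ccompA isoinvr // ccomp_idl.
Qed.

Definition tsh j := projT1 (cid (tsh_ex j)).
Definition lsh j := projT1 (cid (lsh_ex j)).

Lemma tsh_iso j A X : is_iso (tsh j A X).
Proof. by rewrite /tsh; case: cid => t [[]]. Qed.

Lemma tsh_nat j A A' X X' (f : mor A A') (g : mor X X') :
  tsh j A' X' \c tensm f (shm j g) = shm j (tensm f g) \c tsh j A X.
Proof. by rewrite /tsh; case: cid => t [[]]. Qed.

Lemma tsh_lun j X : shm j (lun X) \c tsh j one X = lun (sh j X).
Proof. by rewrite /tsh; case: cid => t [[]]. Qed.

Lemma lsh_iso j A X : is_iso (lsh j A X).
Proof. by rewrite /lsh; case: cid => t []. Qed.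

Lemma lsh_nat j A A' X X' (f : mor A A') (g : mor X X') :
  lsh j A' X' \c tensm (shm j f) g = shm j (tensm f g) \c lsh j A X.
Proof. by rewrite /lsh; case: cid => t []. Qed.

Lemma lsh_trunit j A : shm j (trunit A) \c lsh j A one = trunit (sh j A).
Proof. by rewrite /lsh; case: cid => t []. Qed.

Definition mu i X : mor (tens (sh i one) X) (sh i X) :=
  locked (shm i (lun X) \c lsh i one X).

Lemma muE i X : mu i X = shm i (lun X) \c lsh i one X.
Proof. by rewrite /mu -lock. Qed.

Lemma mu_iso i X : is_iso (mu i X).
Proof. by rewrite muE; apply: iso_comp (shm_iso _ (lun_iso _)) (lsh_iso _ _ _). Qed.

Lemma mu_nat i X Y (f : mor X Y) :
  mu i Y \c tensm (idm (sh i one)) f = shm i f \c mu i X.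
Proof. by rewrite !muE; apply: sq_comp (sq_shm _ (lun_nat f)); rewrite -shm_id lsh_nat. Qed.

Definition act i (a : mor one (sh i one)) X : mor X (sh i X) :=
  locked (mu i X \c (tensm a (idm X) \c isoinv (lun X))).

Lemma actE i (a : mor one (sh i one)) X :
  act a X = mu i X \c (tensm a (idm X) \c isoinv (lun X)).
Proof. by rewrite /act -lock. Qed.

Variables (i : int) (a : mor one (sh i one)).

(** Here the corrections of [lun] and [lsh] pay off: at the unit, all structure maps reduce to the
    right unitor, which cancels by naturality. *)
Lemma act_unit : act a one = a.
Proof.
rewrite actE muE lun_unit lsh_trunit ccompA trunit_nat -ccompA isoinvr ?ccomp_idr //.
exact: trunit_iso.
Qed.

Lemma act_nat X Y (f : mor X Y) : act a Y \c f = shm i f \c act a X.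
Proof.
rewrite !actE; apply: sq_comp (mu_nat i f).
apply: (sq_comp (g := tensm (idm one) f)).
  exact: sq_inv (lun_iso _) (lun_iso _) (lun_nat _).
by rewrite -!tensm_comp !ccomp_idl !ccomp_idr.
Qed.

Lemma actD (b : mor one (sh i one)) X : act (a + b) X = act a X + act b X.
Proof. by rewrite !actE tensmDl ccompDl ccompDr. Qed.

(** Here, and in [act_tens] and [act_mul], compatibility holds up to isomorphisms that absorb signs
    and coherence. That suffices: vanishing, torsion and having a cone in C are invariant under
    composition with isomorphisms. *)
Lemma act_sh j X : exists2 p : mor (sh i (sh j X)) (sh j (sh i X)),
  is_iso p & shm j (act a X) = p \c act a (sh j X).
Proof.
pose q := mu i (sh j X) \c (isoinv (tsh j (sh i one) X) \c isoinv (shm j (mu i X))).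
have iq : is_iso q.
  apply: iso_comp (mu_iso _ _) (iso_comp (iso_isoinv (tsh_iso _ _ _)) _).
  by apply: iso_isoinv; apply: shm_iso; apply: mu_iso.
exists (isoinv q); first exact: iso_isoinv.
apply: (iso_monic iq); rewrite isoKVl // /q !actE 2!shm_comp -!ccompA.
rewrite isoKl; last exact: shm_iso (mu_iso _ _).
congr (_ \c _).
have it := tsh_iso j (sh i one) X; apply: (iso_monic it); rewrite isoKVl //.
rewrite ccompA -[idm (sh j X)]shm_id tsh_nat -!ccompA; congr (_ \c _).
have il := shm_iso j (lun_iso X).
rewrite shm_isoinv; last exact: lun_iso.
by apply: (iso_monic il); rewrite ccompA tsh_lun !isoinvr //; apply: lun_iso.
Qed.

Lemma act_tens A B : exists (p : mor (tens (sh i A) B) (sh i (tens A B)))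
    (q : mor (tens A B) (tens A B)),
  [/\ is_iso p, is_iso q & act a (tens A B) = p \c (tensm (act a A) (idm B) \c q)].
Proof.
pose p := mu i (tens A B) \c (tassoc (sh i one) A B \c isoinv (tensm (mu i A) (idm B))).
pose q := tensm (lun A) (idm B) \c (isoinv (tassoc one A B) \c isoinv (lun (tens A B))).
have im := tensm_iso (mu_iso i A) (iso_id B).
have il := tensm_iso (lun_iso A) (iso_id B).
exists p, q; split.
- exact: iso_comp (mu_iso _ _) (iso_comp (tassoc_iso _ _ _) (iso_isoinv im)).
- apply: iso_comp il (iso_comp (iso_isoinv (tassoc_iso _ _ _)) _).
  exact: iso_isoinv (lun_iso _).
rewrite /p /q !actE -!ccompA; congr (_ \c _).
have split3 X Y Z W (f : mor X Y) (g : mor Y Z) (h : mor Z W) :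
    tensm (h \c (g \c f)) (idm B) =
    tensm h (idm B) \c (tensm g (idm B) \c tensm f (idm B)).
  by rewrite -!tensm_comp !ccomp_idl.
rewrite split3 -!ccompA isoKl //.
have -> : tensm (isoinv (lun A)) (idm B) = isoinv (tensm (lun A) (idm B)).
  apply: (iso_epic il); rewrite isoinvl // -tensm_comp isoinvl ?ccomp_idl ?tensm_id //.
  exact: lun_iso.
rewrite isoKl // !ccompA tassoc_nat tensm_id; congr (_ \c _).
by rewrite -ccompA isoinvr ?ccomp_idr //; apply: tassoc_iso.
Qed.

End Tensor.

Section MoreAct.
Variable K : tt_category.
Implicit Types A B X Y Z W : K.
Local Notation one := (@tunit K).

Lemma act0 i X : act (0 : mor one (sh i one)) X = 0.
Proof. by rewrite actE tensm0l comp0r compr0. Qed.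

Lemma act_gone X : is_iso (act (sh0 one) X).
Proof.
rewrite actE; apply: iso_comp (mu_iso _ _) (iso_comp (tensm_iso (sh0_iso _) (iso_id _)) _).
exact: iso_isoinv (lun_iso _).
Qed.

Lemma act_mul i j k (e : i + j = k) (a : mor one (sh i one)) (b : mor one (sh j one)) X :
  exists2 p : mor (sh j (sh i X)) (sh k X), is_iso p &
    act (hact e a b) X = p \c (shm j (act a X) \c act b X).
Proof.
pose c := mu k X \c (tensm (shD e one) (idm X) \c
   (isoinv (lsh j (sh i one) X) \c isoinv (shm j (mu i X)))).
exists c.
  apply: iso_comp (mu_iso _ _) (iso_comp (tensm_iso (shD_iso _ _) (iso_id _)) _).
  apply: iso_comp (iso_isoinv (lsh_iso _ _ _)) _.
  by apply: iso_isoinv; apply: shm_iso; apply: mu_iso.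
have e1 : shm j (act a X) \c mu j X =
    shm j (mu i X) \c (lsh j (sh i one) X \c tensm (shm j a) (idm X)).
  rewrite actE 2!shm_comp lsh_nat !muE !ccompA; congr (_ \c _).
  rewrite -!ccompA -shm_comp isoinvl ?shm_id ?ccomp_idr //; exact: lun_iso.
rewrite /c [act b X]actE [shm j _ \c (mu j X \c _)]ccompA e1 actE /hact -!ccompA; congr (_ \c _).
rewrite isoKl; last exact: shm_iso (mu_iso _ _).
rewrite isoKl; last exact: lsh_iso.
by rewrite !ccompA -!tensm_comp !ccomp_idl -!ccompA.
Qed.

Lemma act_tensr i (a : mor one (sh i one)) A B : act a A = 0 -> act a (tens B A) = 0.
Proof.
move=> a0; apply: (iso_epic (tsym_iso A B)); rewrite comp0r act_nat.
have [p [q [_ _ ->]]] := act_tens a A B.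
by rewrite a0 tensm0l comp0r !compr0.
Qed.

End MoreAct.

(** * Koszul objects and torsion at a prime *)

Section Action.
Variable K : tt_category.
Implicit Types A B X Y Z W : K.
Local Notation one := (@tunit K).
Local Notation R := (central_ring K).
Local Notation H j X := (mor one (sh j X)).

Lemma hact_act i j k (e : i + j = k) X (m : H i X) (a : H j one) :
  hact e m a = shD e X \c (act a (sh i X) \c m).
Proof. by rewrite act_nat act_unit. Qed.

Lemma hact_nat i j k (e : i + j = k) X Y (f : mor X Y) (m : H i X) (a : H j one) :
  shm k f \c hact e m a = hact e (shm i f \c m) a.
Proof. by rewrite /hact ccompA -shD_nat shm_comp !ccompA. Qed.

Lemma hact_shD i j n k jk l (e1 : i + j = n) (e2 : n + k = l) (e3 : i + jk = l)
    (e4 : j + k = jk) X (m : H j (sh i X)) (a : H k one) :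
  hact e2 (shD e1 X \c m) a = shD e3 X \c hact e4 m a.
Proof. by rewrite /hact shm_comp !ccompA (shDA e1 e2 e4 e3). Qed.

Lemma hact0l i j k (e : i + j = k) X (a : H j one) : hact e (0 : H i X) a = 0.
Proof. by rewrite /hact shm0 comp0r compr0. Qed.

Lemma hact0r i j k (e : i + j = k) X (m : H i X) : hact e m (0 : H j one) = 0.
Proof. by rewrite /hact !compr0. Qed.

Lemma hactNr i j k (e : i + j = k) X (m : H i X) (a : H j one) :
  hact e m (- a) = - hact e m a.
Proof. by rewrite /hact !compNr. Qed.

Lemma hact_id0 i (e : i + 0 = i) X (m : H i X) (c : mor one one) :
  hact e m (sh0 one \c c) = m \c c.
Proof. by rewrite /hact [shm 0 m \c _]ccompA -sh0_nat !ccompA shD0r ccomp_idl. Qed.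

(* A natural transformation between powers of the suspension acts on cohomology
   as a multiplication by an element of the ring: write n : 1 -> Sigma^j X as a
   suspension.  This replaces a sign rule for commuting suspensions. *)
Lemma act_hact i j k (e : i + j = k) (e' : j + i = k) (a : H i one) :
  exists c : mor one one, forall X (n : H j X),
    shD e X \c (shm j (act a X) \c n) = hact e' n (a \c c).
Proof.
set U := sh (- j) one; pose io := shV (addNr j) one.
have ii : is_iso io by apply: shV_iso.
have [f fi fE] := act_sh a j U.
(* P and Q identify Sigma^i 1 with Sigma^k U in two ways; they differ by Sigma^i c, and naturality
   of the action moves c to the right of a. *)
pose P := shD e U \c (f \c shm i io); pose Q := shD e' U \c shm i io.
have iQ : is_iso Q by apply: iso_comp (shD_iso _ _) (shm_iso _ ii).
have [c cE] := shm_full (isoinv Q \c P).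
have PQ : P \c a = Q \c (a \c c).
  have -> : P = Q \c shm i c by rewrite -cE isoKVl.
  by rewrite -ccompA -[a in LHS]act_unit -act_nat act_unit.
exists c => X n; have [n0 ->] := shm_fullV (addNr j) n; rewrite -/U -/io.
have -> : shm j (act a X) \c (shm j n0 \c io) = shm j (shm i n0) \c (shm j (act a U) \c io).
  by rewrite !ccompA -!shm_comp act_nat.
rewrite fE -ccompA [act a _ \c io]act_nat act_unit !ccompA shD_nat.
rewrite -!ccompA ![f \c _]ccompA [shD e U \c _]ccompA -/P PQ.
by rewrite /hact /Q shm_comp !ccompA shD_nat.
Qed.

(** A weak graded commutativity, with a factor of degree 0 in place of a sign; it turns left
    multiples into right multiples. *)
Lemma hact_comm i j k (e : i + j = k) (e' : j + i = k) (a : H i one) (n : H j one) :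
  exists c : H 0 one, hact e a n = hact e' n (hact (addr0 i) a c).
Proof.
have [c cE] := act_hact e e' a; exists (sh0 one \c c).
by rewrite hact_id0 -cE act_unit.
Qed.

Definition lact i (a : H i one) X : mor (sh (- i) X) X :=
  locked (unsh i X \c act a (sh (- i) X)).

Lemma lactE i (a : H i one) X : lact a X = unsh i X \c act a (sh (- i) X).
Proof. by rewrite /lact -lock. Qed.

Lemma lact_nat i (a : H i one) X Y (f : mor X Y) :
  f \c lact a X = lact a Y \c shm (- i) f.
Proof. by rewrite !lactE -ccompA act_nat !ccompA unsh_nat. Qed.

Lemma lact_post i (a : H i one) X Y (f : mor X Y) : f \c lact a X = 0 <-> act a Y \c f = 0.
Proof.
have [p ip pE] := act_sh a (- i) Y.
rewrite lact_nat lactE -ccompA; split=> [|fa].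
  move=> /(iso_compl0 (unsh_iso _ _)) fa.
  by apply: (@shm_eq0 _ (- i)); rewrite shm_comp pE -ccompA fa compr0.
rewrite (_ : act a _ \c _ = 0) ?compr0 //; apply: (iso_compl0 ip).
by rewrite ccompA -pE -shm_comp fa shm0.
Qed.

Lemma shm_lact i (a : H i one) k X : exists2 p, is_iso p &
  shm k (lact a X) = p \c act a (sh k (sh (- i) X)).
Proof.
have [p ip pE] := act_sh a k (sh (- i) X).
exists (shm k (unsh i X) \c p).
  exact: iso_comp (shm_iso _ (unsh_iso _ _)) ip.
by rewrite -ccompA -pE -shm_comp lactE.
Qed.

Lemma shm_lact0 i (a : H i one) k X W (f : mor W (sh k (sh (- i) X))) :
  shm k (lact a X) \c f = 0 <-> act a (sh k (sh (- i) X)) \c f = 0.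
Proof.
have [p ip ->] := shm_lact a k X; split; first by rewrite -ccompA; apply: iso_compl0.
by rewrite -ccompA => ->; rewrite compr0.
Qed.

(** By [act_hact], the map whose cone is taken becomes right multiplication by a multiple of a on
    cohomology. *)
Lemma lact_hact i j (a : H i one) (e : - i + j = j - i) (e' : j - i + i = j) :
  exists c : mor one one, forall X (n : H j (sh (- i) X)),
    shm j (lact a X) \c n = hact e' (shD e X \c n) (a \c c).
Proof.
have [c cE] := act_hact (erefl (i + j)) (addrC j i) a; exists c => X n.
have e2 : - i + (i + j) = j by rewrite addKr.
rewrite (hact_shD e e' e2 (addrC j i)) -cE !ccompA lactE shm_comp.
by rewrite (shm_unsh X erefl e2).
Qed.

Lemma dist_transport X Y Z X' Y' (f : mor X Y) (g : mor Y Z) (h : mor Z (Sg X))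
    (f' : mor X' Y') (a : mor X X') (b : mor Y Y') :
  dist f g h -> is_iso a -> is_iso b -> b \c f = f' \c a ->
  exists g' h', dist f' (g' : mor Y' Z) h'.
Proof.
move=> d ia ib e; exists (g \c isoinv b), (Sgm a \c h).
apply: (dist_iso (c := idm Z) ia ib (iso_id Z) e _ _ d).
  by rewrite ccomp_idl isoKVr.
by rewrite ccomp_idr.
Qed.

Definition kcone i (a : H i one) : K := projT1 (cid (dist_cone (lact a one))).

Lemma kconeP i (a : H i one) : exists g h, dist (lact a one) (g : mor one (kcone a)) h.
Proof. by rewrite /kcone; case: cid. Qed.

Definition koszul i (a : H i one) X : K := tens (kcone a) X.

(** The triangle of [kcone a] is tensored with X and transported along Sigma^(-i) 1 (x) X ~
    Sigma^(-i) X. *)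
Lemma koszulP i (a : H i one) X : exists g h, dist (lact a X) (g : mor X (koszul a X)) h.
Proof.
have [g [h d]] := kconeP a; set A := sh (- i) one.
have [p [q [ip iq E]]] := act_tens a A X.
pose nu := mu (- i) X : mor (tens A X) (sh (- i) X).
have inu : is_iso nu by apply: mu_iso.
pose un := tensm (unsh i one) (idm X).
have iun : is_iso un by apply: tensm_iso (unsh_iso _ _) (iso_id _).
pose b := unsh i X \c (shm i nu \c (p \c isoinv un)).
apply: (dist_transport (a := nu \c isoinv q) (b := b) (tens_exactl X d)).
- exact: iso_comp inu (iso_isoinv iq).
- apply: iso_comp (unsh_iso _ _) (iso_comp (shm_iso _ inu) (iso_comp ip _)).
  exact: iso_isoinv.
have -> : tensm (lact a one) (idm X) = un \c tensm (act a A) (idm X).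
  by rewrite -tensm_comp ccomp_idl lactE.
rewrite /b -!ccompA isoKl // -[tensm (act a A) _](isoKr _ iq).
rewrite [p \c _]ccompA -E lactE -ccompA; congr (_ \c _).
by rewrite !ccompA act_nat.
Qed.

(** On the cone, a kills g and so factors through the connecting map h; since a also kills h, its
    square is zero. *)
Lemma koszul_sq i (a : H i one) X : act (hact erefl a a) (koszul a X) = 0.
Proof.
have [g [h d]] := koszulP a X; set Z := koszul a X in g h d *.
have [|v vE] := dist_ext' (m := act a Z) d; first by apply/lact_post; apply: dist_comp0 d.
have /(shm_lact0 a) := dist_Sg_comp0 d.
rewrite act_nat => h0; have [p _ ->] := act_mul erefl a a Z.
by rewrite {1}vE shm_comp -ccompA h0 !compr0.
Qed.

(** The hypothesis amounts to a (x) f = 0, and associativity tensors this with B. *)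
Lemma act_tens_comp0 i (a : H i one) A A' B (f : mor A A') :
  act a A' \c f = 0 -> act a (tens A' B) \c tensm f (idm B) = 0.
Proof.
move=> e.
have e1 : tensm a f = 0.
  have -> : tensm a f = tensm a (idm A') \c tensm (idm one) f.
    by rewrite -tensm_comp ccomp_idl ccomp_idr.
  apply: (iso_compl0 (mu_iso i A')); apply: (iso_compr0 (iso_isoinv (lun_iso A))).
  have -> : tensm (idm one) f = isoinv (lun A') \c (f \c lun A).
    by rewrite -lun_nat isoKl //; apply: lun_iso.
  rewrite -!ccompA isoinvr ?ccomp_idr; last exact: lun_iso.
  by rewrite -[RHS]e actE -!ccompA.
have e2 : tensm a (tensm f (idm B)) = 0.
  apply: (iso_compr0 (tassoc_iso one A B)).
  by rewrite -tassoc_nat e1 tensm0l compr0.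
rewrite actE -!ccompA (sq_inv (lun_iso _) (lun_iso _) (lun_nat _)).
rewrite [tensm a _ \c _]ccompA -tensm_comp ccomp_idl ccomp_idr e2.
by rewrite comp0r compr0.
Qed.

End Action.

(** * Localization at a prime, expressed by torsion *)

Section Torsion.
Variable K : tt_category.
Implicit Types A B X Y Z W : K.
Local Notation one := (@tunit K).
Local Notation R := (central_ring K).
Local Notation H j X := (mor one (sh j X)).
Variable p : Spec R.

(** This is the vanishing of f after localization of K at p. *)
Definition ptors X Y (f : mor X Y) :=
  exists (i : int) (s : H i one), ~ p i s /\ act s Y \c f = 0.

Lemma ptors_l X Y Z (f : mor X Y) (g : mor Y Z) : ptors f -> ptors (g \c f).
Proof.
by move=> [i [s [ps e]]]; exists i, s; split=> //; rewrite ccompA act_nat -ccompA e compr0.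
Qed.

Lemma ptors_r X Y Z (f : mor X Y) (g : mor Y Z) : ptors g -> ptors (g \c f).
Proof.
by move=> [i [s [ps e]]]; exists i, s; split=> //; rewrite ccompA e comp0r.
Qed.

Lemma ptors_iso_l X Y Z (f : mor X Y) (g : mor Y Z) : is_iso g -> ptors (g \c f) -> ptors f.
Proof. by move=> i /(ptors_l (isoinv g)); rewrite isoKl. Qed.

Lemma ptors_iso_r X Y Z (f : mor X Y) (g : mor Y Z) : is_iso f -> ptors (g \c f) -> ptors g.
Proof. by move=> i /(ptors_r (isoinv f)); rewrite isoKr. Qed.

Lemma ptors_sh j X Y (f : mor X Y) : ptors (shm j f) <-> ptors f.
Proof.
split=> -[i [s [ps e]]]; exists i, s; split=> //; have [q iq qE] := act_sh s j Y.
  by apply: (@shm_eq0 _ j); rewrite shm_comp qE -ccompA e compr0.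
by apply: (iso_compl0 iq); rewrite ccompA -qE -shm_comp e shm0.
Qed.

Lemma ptors0 X Y : ptors (0 : mor X Y).
Proof. by exists 0, (sh0 one); split; [apply: hprime1 | rewrite compr0]. Qed.

Lemma ptorsN X Y (f : mor X Y) : ptors f -> ptors (- f).
Proof. by move=> [i [s [ps e]]]; exists i, s; rewrite compNr e oppr0. Qed.

Lemma ptors_act i (s : H i one) X Y (f : mor X Y) :
  ~ p i s -> ptors (act s Y \c f) -> ptors f.
Proof.
move=> ps [j [t [pt e]]]; exists (j + i), (hact erefl t s); split.
  by move=> /hprimeM[].
have [q _ ->] := act_mul erefl t s Y; have [r _ ->] := act_sh t i Y.
by rewrite -!ccompA e !compr0.
Qed.

Lemma ptorsD X Y (f f' : mor X Y) : ptors f -> ptors f' -> ptors (f + f').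
Proof.
move=> [i [s [ps e]]] [j [t [pt e']]]; apply: (ptors_act ps).
by exists j, t; split=> //; rewrite ccompDr e add0r ccompA act_nat -ccompA e' compr0.
Qed.

Lemma ptorsB X Y (f f' : mor X Y) : ptors f -> ptors f' -> ptors (f - f').
Proof. by move=> tf tf'; apply: ptorsD tf (ptorsN tf'). Qed.

Lemma ptors_zero X Y (f : mor X Y) : is_zero X -> ptors f.
Proof. by move=> z; rewrite (zero_from f z); apply: ptors0. Qed.

Lemma ptors_tensl X Y B (f : mor X Y) : ptors f -> ptors (tensm f (idm B)).
Proof.
move=> [i [s [ps e]]]; exists i, s; split=> //; exact: act_tens_comp0.
Qed.

Lemma ptors_act_tensl i (a : H i one) A B : ptors (act a A) -> ptors (act a (tens A B)).
Proof.
move=> t; have [q [r [_ _ ->]]] := act_tens a A B.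
by apply: ptors_l; apply: ptors_r; apply: ptors_tensl.
Qed.

Lemma ptors_act_iso i (a : H i one) A B : isomorphic A B -> ptors (act a A) -> ptors (act a B).
Proof.
move=> [f fi] t; apply: (ptors_iso_r fi); rewrite act_nat; exact: ptors_l.
Qed.

Lemma ptors_act_tensr i (a : H i one) A B : ptors (act a A) -> ptors (act a (tens B A)).
Proof.
move=> /(ptors_act_tensl B); apply: ptors_act_iso.
by exists (tsym A B); apply: tsym_iso.
Qed.

Lemma ptors_act_sh i (a : H i one) j A : ptors (act a A) -> ptors (act a (sh j A)).
Proof.
have [q iq qE] := act_sh a j A.
by move=> /(ptors_sh j); rewrite qE; apply: ptors_iso_l.
Qed.

Lemma ptors_hact i j k (e : i + j = k) X (m : H i X) (a : H j one) :
  ptors m -> ptors (hact e m a).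
Proof.
by move=> tm; rewrite /hact; apply: ptors_l; apply: ptors_r; apply/ptors_sh.
Qed.

Lemma ptors_hactK i j k (e : i + j = k) X (m : H i X) (s : H j one) :
  ~ p j s -> ptors (hact e m s) -> ptors m.
Proof.
rewrite hact_act => ps /(ptors_iso_l (shD_iso _ _)); exact: ptors_act.
Qed.

Lemma ptorsP i X (m : H i X) :
  ptors m <-> exists j (s : H j one), ~ p j s /\ hact erefl m s = 0.
Proof.
split=> -[j [s [ps e]]]; exists j, s; split=> //; move: e; rewrite hact_act.
  by move=> ->; rewrite compr0.
exact: iso_compl0 (shD_iso _ _).
Qed.

Definition acyclic X := forall j (m : H j X), ptors m.

Lemma acyclicP X : Supp (cohomology X) p <-> ~ acyclic X.
Proof.
split=> [[d [[nd dd m s ps e] h]] ac|].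
  apply: h; have /ptorsP[j [t [pt mt]]] := ac nd m.
  exists j, t; split=> //=.
  (* An element t killing m also kills the multiples of m, by commutativity up to a factor of degree
     0. *)
  have {}mt k l n (e1 : nd + k = l) (e2 : l + j = n) (u : H k one) :
      hact e2 (hact e1 m u) t = 0.
    have [c cE] := hact_comm erefl (addrC j k) u t.
    have e3 : nd + (k + j) = n by rewrite addrA e1.
    have e4 : nd + j + k = n by rewrite -e3 -addrA [j + k]addrC.
    by rewrite (hactA e1 e2 erefl e3) cE -(hactA erefl e4 (addrC j k)) mt hact0l.
  by rewrite mt /= hact0l hact0l.
apply: contra_notP => nS j m; apply: contrapT => nm; apply: nS.
exists j, (floc_of p (m : cohomology X j)) => -[i [u [pu /= e]]].
apply: nm; apply: (ptors_hactK (e := erefl) (hprime1 (s := p))).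
apply/ptorsP; exists i, u; split=> //.
move: e; rewrite hact0l hact0l; exact.
Qed.

Lemma acyclic_thick : thick acyclic.
Proof.
split.
- by move=> X z j m; rewrite (zero_to m (sh_zero j z)); apply: ptors0.
- by move=> n X ac j m; apply: (ptors_iso_l (shD_iso erefl X)); apply: ac.
- move=> X Y Z f g h d aX aY j m.
  have [i [s [ps e]]] : ptors (shm j h \c m).
    by apply: (ptors_iso_l (shD_iso erefl X)); apply: aX.
  have {}e : shm (j + i) h \c hact erefl m s = 0.
    by rewrite hact_nat hact_act e compr0.
  have [n nE] := shm_dist_lift' d e.
  by apply: (ptors_hactK (e := erefl) ps); rewrite nE; apply/ptors_l/aY.
- move=> X Y W [i1 [i2 [p1 [p2 [e _ _ _ _]]]]] aW j m.
  have -> : m = shm j p1 \c (shm j i1 \c m) by rewrite ccompA -shm_comp e shm_id ccomp_idl.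
  by apply/ptors_l/aW.
Qed.

Lemma ptors_unit n b X (f : mor (sh n one) (sh b X)) :
  (forall m : H (b - n) X, ptors m) -> ptors f.
Proof.
move=> t; apply/(ptors_sh (- n)); apply: (ptors_iso_r (shV_iso (subrr n) one)).
by apply: (ptors_iso_l (shD_iso erefl X)); apply: t.
Qed.

(** Devissage from the unit: the objects A for which all maps from suspensions of A to suspensions
    of X are torsion form a thick subcategory. *)
Lemma acyclic_id X : thick_gen one X -> acyclic X -> ptors (idm X).
Proof.
move=> gX aX; pose T A := forall n b (f : mor (sh n A) (sh b X)), ptors f.
suff tT : thick T.
  have T1 : T one by move=> n b f; apply: ptors_unit => m; apply: aX.
  have := gX T tT T1 0 0 (shm 0 (idm X)).
  by move/ptors_sh.
split.
- by move=> A z n b f; apply/ptors_zero/sh_zero.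
- move=> k A tA n b f; apply: (ptors_iso_r (iso_isoinv (shD_iso erefl A))); exact: tA.
- move=> A B C f g h d tA tB n b m.
  have [i [s [ps e]]] := tB n b (m \c shm n g).
  rewrite ccompA in e; have [m' m'E] := shm_dist_ext' d e.
  apply: (ptors_act ps); rewrite m'E; apply: ptors_r.
  apply: (ptors_iso_r (iso_isoinv (shD_iso erefl A))).
  by apply: (ptors_iso_l (shD_iso erefl X)); apply: tA.
- move=> A B C [i1 [i2 [p1 [p2 [e _ _ _ _]]]]] tC n b f.
  have -> : f = f \c shm n p1 \c shm n i1 by rewrite -ccompA -shm_comp e shm_id ccomp_idr.
  by apply/ptors_r/tC.
Qed.

End Torsion.

(** * Noetherian cohomology *)

Definition acc (I : Type) (D : I -> Type) (ok : (forall i, D i -> Prop) -> Prop) :=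
  forall N : nat -> forall i, D i -> Prop,
    (forall n, ok (N n)) -> (forall n i x, N n i x -> N n.+1 i x) ->
    exists k, forall n, (k <= n)%N -> forall i x, N n i x -> N k i x.

(** Without a maximal member, dependent choice would produce a strictly increasing chain. *)
Lemma acc_max (I : Type) (D : I -> Type) (ok : (forall i, D i -> Prop) -> Prop)
    (T : Type) (N : T -> forall i, D i -> Prop) (Q : T -> Prop) (t0 : T) :
  acc ok -> (forall t, Q t -> ok (N t)) -> Q t0 ->
  exists t, Q t /\ forall t', Q t' -> (forall i x, N t i x -> N t' i x) ->
    forall i x, N t' i x -> N t i x.
Proof.
move=> accN okN Q0; apply: contrapT => nmax.
have /choice[next nextP] (t : {t | Q t}) : exists t' : {t | Q t},
    (forall i x, N (sval t) i x -> N (sval t') i x) /\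
    ~ (forall i x, N (sval t') i x -> N (sval t) i x).
  apply: contrapT => nt; apply: nmax; exists (sval t); split=> [|t' Qt' le]; first exact: svalP.
  by apply: contrapT => nle; apply: nt; exists (exist _ t' Qt').
pose c n := iter n next (exist _ t0 Q0).
have [n|n i x|k kP] := accN (fun n => N (sval (c n))).
- exact: okN (svalP (c n)).
- exact: (nextP (c n)).1.
by apply: (nextP (c k)).2 => i x; apply: (kP k.+1).
Qed.

Section Modules.
Variable K : tt_category.
Implicit Types A B X Y Z W : K.
Local Notation one := (@tunit K).
Local Notation R := (central_ring K).
Local Notation H j X := (mor one (sh j X)).

Record submod X (N : forall i, H i X -> Prop) : Prop := Submod {
  submod0 : forall i, N i 0;
  submodD : forall i m m', N i m -> N i m' -> N i (m + m');
  submod_act : forall i j k (e : i + j = k) m (a : H j one), N i m -> N k (hact e m a)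
}.

Lemma submodN X (N : forall i, H i X -> Prop) i (m : H i X) : submod N -> N i m -> N i (- m).
Proof.
by move=> sN /(submod_act sN (addr0 i) (- sh0 one)); rewrite hactNr hact1.
Qed.

Definition noeth X := acc (@submod X).

(** Exactness in the middle is enough: a chain in H^*Y is stationary once its preimages in H^*X and
    its images in H^*Z are. *)
Lemma noeth_ext X Y Z (f : mor X Y) (g : mor Y Z) :
  (forall j (m : H j Y), shm j g \c m = 0 -> exists n, m = shm j f \c n) ->
  noeth X -> noeth Z -> noeth Y.
Proof.
move=> ex nX nZ N sN leN.
have leN' m n : (m <= n)%N -> forall i x, N m i x -> N n i x.
  move/subnK <-; elim: (n - m)%N => [|k IH] i x // Nx.
  by apply: leN; apply: IH.
have [n|n i x|k1 k1P] := nX (fun n i m => N n i (shm i f \c m)).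
- split=> [i|i m m'|i j k e m a]; first by rewrite compr0; apply: submod0.
    by rewrite ccompDr; apply: submodD.
  by rewrite hact_nat; apply: submod_act.
- exact: leN.
have [n|n i x|k2 k2P] := nZ (fun n i z => exists2 m, N n i m & z = shm i g \c m).
- split=> [i|i _ _ [m Nm ->] [m' Nm' ->]|i j k e _ a [m Nm ->]].
  + by exists 0; rewrite ?compr0 //; apply: submod0.
  + by exists (m + m'); rewrite ?ccompDr //; apply: submodD.
  by exists (hact e m a); rewrite ?hact_nat //; apply: submod_act.
- by move=> [m Nm ->]; exists m => //; apply: leN.
exists (maxn k1 k2) => n; rewrite geq_max => /andP[k1n k2n] i x Nx.
have [|y Ny yE] := k2P n k2n i (shm i g \c x); first by exists x.
have Ny' m : (k2 <= m)%N -> N m i y by move=> km; apply: leN' Ny.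
have [|z zE] := ex i (x - y); first by rewrite compBr yE subrr.
have /(k1P n k1n) Nz : N n i (shm i f \c z).
  by rewrite -zE; apply: submodD => //; apply: submodN => //; apply: Ny'.
rewrite -(subrK y x) zE; apply: submodD => //.
  by apply: leN' Nz; apply: leq_maxl.
by apply: Ny'; apply: leq_maxr.
Qed.

Lemma noeth_zero X : is_zero X -> noeth X.
Proof.
move=> z N sN leN; exists 0%N => n _ i x _.
by rewrite (zero_to x (sh_zero i z)); apply: submod0.
Qed.

Lemma noeth_sh n X : noeth X -> noeth (sh n X).
Proof.
move=> nX N sN leN.
have inv (i l : int) (e : n + i = l) (m : H l X) : exists m', shD e X \c m' = m.
  by exists (isoinv (shD e X) \c m); rewrite isoKVl //; apply: shD_iso.
have inj (i l : int) (e : n + i = l) (m m' : H i (sh n X)) :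
    shD e X \c m = shD e X \c m' -> m = m' by apply/iso_monic/shD_iso.
(* The chain is regraded to H^*X; quantifying over i with n + i = l avoids transports between
   degrees. *)
have [q|q l m Nm i e m' mE|k kP] :=
  nX (fun q l m => forall i (e : n + i = l) m', shD e X \c m' = m -> N q i m').
- split=> [l i e m|l m m' Nm Nm' i e y yE|l j k e m a Nm i e' y yE].
  + by rewrite -[X in _ = X](compr0 _ (shD e X)) => /inj->; apply: submod0.
  + have [[x xE] [x' xE']] := (inv i l e m, inv i l e m').
    have -> : y = x + x' by apply: (inj _ _ e); rewrite ccompDr xE xE'.
    by apply: (submodD (sN q)); [apply: Nm xE | apply: Nm' xE'].
  + have e1 : n + (l - n) = l by rewrite addrC subrK.
    have e4 : l - n + j = i by apply: (addrI n); rewrite addrA e1 e.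
    have [x xE] := inv _ _ e1 m.
    have -> : y = hact e4 x a by apply: (inj _ _ e'); rewrite yE -xE (hact_shD e1 e e' e4).
    by apply: submod_act => //; apply: Nm xE.
- by apply: leN; apply: Nm mE.
exists k => q kq i x Nx; apply: (kP q kq (n + i) (shD erefl X \c x) _ i erefl) => //.
move=> i' e x'; have ii : i' = i by apply: addrI e.
by subst i'; rewrite (eq_irrelevance e erefl) => /inj->.
Qed.

Lemma noeth_thick : thick noeth.
Proof.
split; [exact: noeth_zero | exact: noeth_sh | |].
- move=> X Y Z f g h d nX nY.
  apply: (noeth_ext (f := g) (g := h)) nY _ => [j m|]; last exact: noeth_sh.
  exact: shm_dist_lift' d.
- move=> X Y W [i1 [i2 [p1 [p2 [e _ _ _ _]]]]] nW.
  have [Z zZ] := zero_ex K.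
  apply: (noeth_ext (f := 0 : mor Z X) (g := i1)) nW; last exact: noeth_zero.
  move=> j m im; exists 0; rewrite compr0.
  by rewrite -[m]ccomp_idl -shm_id -e shm_comp -ccompA im compr0.
Qed.

Lemma right_ideal (N : forall i, H i one -> Prop) : submod N -> is_hideal (R := R) N.
Proof.
move=> sN; split.
- exact: submod0.
- exact: submodD.
- move=> i j k e a b Nb; rewrite /=.
  have e' : j + i = k by rewrite addrC.
  have [c ->] := hact_comm e e' a b; exact: submod_act.
- by move=> i j k e a b; apply: submod_act.
Qed.

Lemma noeth_all : hnoetherian R -> (forall X : K, thick_gen one X) -> forall X, noeth X.
Proof.
move=> nR gen X; apply: (gen X _ noeth_thick) => N sN leN.
have [n|n i x|k kP] := nR N.
- exact: right_ideal.
- exact: leN.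
by exists k => n kn i x; rewrite (kP n kn).
Qed.

End Modules.

(** * Nakayama's lemma *)

Section Saturation.
Variable K : tt_category.
Implicit Types A B X Y Z W : K.
Local Notation one := (@tunit K).
Local Notation R := (central_ring K).
Local Notation H j X := (mor one (sh j X)).
Variable p : Spec R.

Lemma hact_swap k j l u v w (e1 : k + j = u) (e2 : u + l = v) (e3 : k + l = w)
    (e4 : w + j = v) X (x : H k X) (a : H j one) (s : H l one) :
  exists c, hact e2 (hact e1 x a) s = hact e4 (hact e3 x s) (hact (addr0 j) a c).
Proof.
have e5 : k + (j + l) = v by rewrite addrA e1.
have [c cE] := hact_comm erefl (addrC l j) a s; exists c.
by rewrite (hactA e1 e2 erefl e5) cE -(hactA e3 e4 (addrC l j)).
Qed.

(** The contraction to H^*X of the localization of P at p. *)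
Definition sat X (P : forall i, H i X -> Prop) k (x : H k X) : Prop :=
  exists l (s : H l one), ~ p l s /\ P (k + l) (hact erefl x s).

Lemma sat_incl X (P : forall i, H i X -> Prop) k (x : H k X) : submod P -> P k x -> sat P x.
Proof.
by move=> sP Px; exists 0, (sh0 one); split; [apply: hprime1 | apply: submod_act].
Qed.

Lemma sat_den X (P : forall i, H i X -> Prop) k (x : H k X) l m (e : k + l = m) (s : H l one) :
  ~ p l s -> P m (hact e x s) -> sat P x.
Proof. by move=> ps; subst m => Px; exists l, s. Qed.

Lemma sat_submod X (P : forall i, H i X -> Prop) : submod P -> submod (sat P).
Proof.
move=> sP; split.
- move=> i; apply: sat_incl => //; exact: submod0.
- move=> i m m' [l [s [ps Pm]]] [l' [s' [ps' Pm']]].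
  have e : i + (l + l') = i + l + l' by rewrite addrA.
  apply: (sat_den (e := e) (s := hact erefl s s')); first by move/hprimeM => [].
  rewrite hactDl; apply: submodD => //.
    by rewrite -(hactA erefl erefl); apply: submod_act.
  rewrite -(hactA erefl erefl).
  have e' : i + l' + l = i + l + l' by rewrite addrAC.
  have [c ->] := hact_swap erefl erefl erefl e' m' s s'; exact: submod_act.
- move=> i j k e m a [l [s [ps Pm]]].
  have e' : i + l + j = k + l by rewrite -e addrAC.
  apply: (sat_den (e := erefl) ps).
  have [c ->] := hact_swap e erefl erefl e' m a s; exact: submod_act.
Qed.

Lemma sat_sat X (P Q : forall i, H i X -> Prop) :
  (forall i x, P i x -> sat Q x) -> forall i (x : H i X), sat P x -> sat Q x.
Proof.
move=> PQ i x [l [s [ps /PQ[l' [s' [ps' Qx]]]]]].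
have e : i + (l + l') = i + l + l' by rewrite addrA.
apply: (sat_den (e := e) (s := hact erefl s s')); first by move/hprimeM => [].
by rewrite -(hactA erefl erefl).
Qed.

Definition cyc X j (m : H j X) k (x : H k X) : Prop :=
  exists d (e : j + d = k) (r : H d one), x = hact e m r.

Lemma cyc_self X j (m : H j X) : cyc m m.
Proof. by exists 0, (addr0 j), (sh0 one); rewrite hact1. Qed.

Lemma cyc_submod X j (m : H j X) : submod (cyc m).
Proof.
split.
- move=> i; have e : j + (i - j) = i by rewrite addrC subrK.
  by exists (i - j), e, 0; rewrite hact0r.
- move=> i _ _ [d [e [r ->]]] [d' [e' [r' ->]]].
  have dd : d' = d by apply: (addrI j); rewrite e e'.
  subst d'; rewrite (eq_irrelevance e' e); exists d, e, (r + r').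
  by rewrite hactDr.
- move=> i k l e _ a [d [e' [r ->]]].
  have e2 : j + (d + k) = l by rewrite addrA e'.
  by exists (d + k), e2, (hact erefl r a); rewrite (hactA e' e erefl e2).
Qed.

Lemma cyc_sub X j (m : H j X) (P : forall i, H i X -> Prop) :
  submod P -> P j m -> forall i (x : H i X), cyc m x -> P i x.
Proof. by move=> sP Pm i _ [d [e [r ->]]]; apply: submod_act. Qed.

(** If the cone were acyclic, every class would be divisible at p by an element of p. This is
    contradicted at a non-torsion class whose saturated cyclic submodule is maximal. *)
Lemma nakayama X i (a : H i one) :
  noeth X -> p i a -> ~ acyclic p X -> ~ acyclic p (koszul a X).
Proof.
move=> nX pa nac ac; apply: nac => j0 m0; apply: contrapT => nt0.
have pr := hprime_ideal p.
have [g [h d]] := koszulP a X.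
(* The image of m in the cone is torsion, so some m s lifts through [lact a]. *)
have div j (m : H j X) : exists l (s : H l one) j' (n : H j' X) (b : H i one)
    (e : j' + i = j + l), [/\ ~ p l s, p i b & hact erefl m s = hact e n b].
  have /ptorsP[l [s [ps e]]] := ac j (shm j g \c m).
  rewrite -hact_nat in e; have [n nE] := shm_dist_lift d e.
  have e1 : - i + (j + l) = j + l - i by rewrite addrC.
  have e2 : j + l - i + i = j + l by rewrite subrK.
  have [c cE] := lact_hact a e1 e2.
  exists l, s, (j + l - i), (shD e1 X \c n), (a \c c), e2; split=> //.
    rewrite -(hact_id0 (addr0 i) a c); exact: (hidealMr pr (addr0 i) _ pa).
  by rewrite nE.
have [[j m] /= [nt max]] := acc_max
  (N := fun t : {j : int & H j X} => sat (cyc (tagged t)))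
  (Q := fun t => ~ ptors p (tagged t)) (t0 := Tagged (fun j => H j X) m0) nX
  (fun t _ => sat_submod (cyc_submod (tagged t))) nt0.
have [l [s [j' [n [b [e [ps pb E]]]]]]] := div j m.
have ntn : ~ ptors p n.
  move=> tn; apply: nt; apply: (ptors_hactK (e := erefl) ps).
  by rewrite E; apply: ptors_hact.
(* As m s = n b, the saturation for n contains that for m, and maximality gives n t = m r. *)
have [||l2 [t [pt [d2 [e2 [r rE]]]]]] := max (Tagged (fun j => H j X) n) ntn _ j' n.
- apply: sat_sat => k x; apply: cyc_sub; first exact/sat_submod/cyc_submod.
  by exists l, s; split=> //; exists i, e, b.
- by apply: sat_incl; [apply: cyc_submod | apply: cyc_self].
apply: nt.
have e3 : j' + l2 + i = j + l + l2 by rewrite -e addrAC.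
have [c cE] := hact_swap e erefl erefl e3 n b t.
have e4 : d2 + i = l + l2.
  by apply: (addrI j); rewrite !addrA e2 -e addrAC.
have e5 : j + (l + l2) = j + l + l2 by rewrite addrA.
have pb' : p (l + l2) (hact e4 r (hact (addr0 i) b c)).
  exact: (hidealMl pr e4 r (hidealMr pr (addr0 i) c pb)).
(* Since m s t = n b t = n t b c = m r b c, the class m is killed by s t - r b c, which is outside p
   because b is in p. *)
apply: (ptors_hactK (e := e5) (s := hact erefl s t - hact e4 r (hact (addr0 i) b c))).
  move=> pd; have /hprimeM[] // : p (l + l2) (gmul erefl (s : R l) (t : R l2)).
  have := hidealD pr pd pb'; by rewrite subrK.
rewrite hactDr hactNr -(hactA erefl erefl) E cE -(hactA e2 e3) -rE subrr.
exact: ptors0.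
Qed.

Lemma dist_lact_tors i (a : H i one) X Z (g : mor X Z) h j (m : H j Z) :
  (forall k l (e : k + i = l) (n : H k X), hact e n a = 0 -> ptors p n) ->
  dist (lact a X) g h -> ptors p (shm j h \c m).
Proof.
move=> reg d; have e1 : 1 + j = j + 1 by rewrite addrC.
apply: (ptors_iso_l (shD_iso e1 _)); apply: (ptors_iso_l (shD_iso erefl _)).
apply: (reg _ _ erefl); rewrite hact_act.
have z : act a (sh j (Sg (sh (- i) X))) \c (shm j h \c m) = 0.
  have [q iq qE] := shm_lact a 1 X; have [r ir rE] := act_sh a j (Sg (sh (- i) X)).
  apply: (iso_compl0 (iso_comp (shm_iso j iq) ir)).
  rewrite -!ccompA [r \c _]ccompA -rE ccompA -shm_comp -qE ccompA -shm_comp.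
  by rewrite (dist_Sg_comp0 d) shm0 comp0r.
rewrite [act a _ \c _]ccompA act_nat -ccompA [act a _ \c _]ccompA act_nat -ccompA.
by rewrite z !compr0.
Qed.

(* [act a] kills the bottom cell of the cone of a, so it factors through a
   cohomology class of odd degree. *)
Lemma ptors_kcone i (a : H i one) : even_degrees R ->
  (forall j k (e : j + i = k) (n : H j one), ptors p (hact e n a) -> ptors p n) ->
  ptors p (act a (kcone a)).
Proof.
move=> ev reg; have [g [h d]] := kconeP a; set E := kcone a in g h d *.
have odd0 j (n : H j one) : odd `|j|%N -> n = 0 by apply: (ev j n).
(* By regularity h m is torsion, so a multiple m s comes from the unit; s is nonzero, hence even,
   and that class has odd degree. *)
have oddE j (m : H j E) : odd `|j|%N -> ptors p m.
  move=> oj.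
  have [k [s [ps e]]] : ptors p (shm j h \c m).
    apply: dist_lact_tors d => l l' el n na; apply: (reg _ _ el).
    by rewrite na; apply: ptors0.
  have {}e : shm (j + k) h \c hact erefl m s = 0.
    by rewrite hact_nat hact_act e compr0.
  have [n nE] := shm_dist_lift' d e.
  have ek : ~~ odd `|k|%N.
    by apply/negP => /odd0 s0; apply: ps; rewrite (s0 s); apply: (hideal0 (hprime_ideal p)).
  apply: (ptors_hactK (e := erefl) ps).
  rewrite nE (odd0 _ n) ?compr0; first exact: ptors0.
  lia.
have [|v vE] := dist_ext' (m := act a E) d; first by apply/lact_post; apply: dist_comp0 d.
rewrite vE; apply: ptors_r.
(* The map v amounts to a class of degree i - (1 - i) = 2 i - 1, which is odd. *)
have e1 : - i + 1 = 1 - i by rewrite addrC.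
apply: (ptors_iso_r (iso_isoinv (shD_iso e1 one))).
apply: ptors_unit => m; apply: oddE; lia.
Qed.

End Saturation.

(** * Regular sequences through numerators *)

Section RegularSequence.
Variables (R : gring) (p : Spec R).
Local Notation rloc := (floc p (gregular R)).

Lemma gmul_1m (i j k l : int) (e1 : i + 0 = k) (e2 : k + j = l) (e3 : i + j = l)
    (a : R i) (b : R j) :
  gmul e2 (gmul e1 a gone) b = gmul e3 a b.
Proof. by rewrite (gmulA e1 e2 (add0r j) e3) gmul1l. Qed.

Lemma gmul_m1l (i j k l : int) (e1 : 0 + j = k) (e2 : i + k = l) (e3 : i + j = l)
    (a : R i) (b : R j) :
  gmul e2 a (gmul e1 gone b) = gmul e3 a b.
Proof.
have jk : j = k by rewrite -e1 add0r.
by case: k / jk e1 e2 => e1 e2; rewrite (gmul1l e1) (eq_irrelevance e2 e3).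
Qed.

Lemma gmul_m1r (i j k l : int) (e1 : j + 0 = k) (e2 : i + k = l) (e3 : i + j = l)
    (a : R i) (b : R j) :
  gmul e2 a (gmul e1 b gone) = gmul e3 a b.
Proof.
have jk : j = k by rewrite -e1 addr0.
by case: k / jk e1 e2 => e1 e2; rewrite (gmul1r e1) (eq_irrelevance e2 e3).
Qed.

Lemma gmul0l (i j k : int) (e : i + j = k) (b : R j) : gmul e (0 : R i) b = 0.
Proof. by apply: (addrI (gmul e (0 : R i) b)); rewrite -gmulDl !addr0. Qed.

(* The homogeneous ideals of R_p correspond to these ideals of R. *)
Definition satideal (J : forall i, R i -> Prop) :=
  is_hideal J /\
  forall i j k (e : i + j = k) (x : R i) (s : R j), ~ p j s -> J k (gmul e x s) -> J i x.

Definition sgen (S : {i : int & R i} -> Prop) i (x : R i) : Prop :=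
  forall J, satideal J -> (forall a, S a -> J (tag a) (tagged a)) -> J i x.

Lemma sgen_sat S : satideal (sgen S).
Proof.
split; first split.
- by move=> i J [iJ _] _; apply: hideal0.
- by move=> i a b Sa Sb J sJ SJ; have := hidealD sJ.1 (Sa J sJ SJ) (Sb J sJ SJ).
- by move=> i j k e a b Sb J sJ SJ; have := hidealMl sJ.1 e a (Sb J sJ SJ).
- by move=> i j k e a b Sa J sJ SJ; have := hidealMr sJ.1 e b (Sa J sJ SJ).
- move=> i j k e x s ps Sx J sJ SJ; exact: (sJ.2 _ _ _ _ _ _ ps (Sx J sJ SJ)).
Qed.

Lemma rloc_of_sat (J : forall i, R i -> Prop) : satideal J ->
  is_rloc_ideal (fun d (x : rloc d) => J _ (fnum x)).
Proof.
move=> [iJ sJ]; split=> /=.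
- move=> d x y [i [u [pu /= e]]] Jx.
  apply: (sJ _ _ _ (floc_cross x y) _ _ (@fdenP _ _ _ _ x)).
  apply: (sJ _ _ _ erefl _ _ pu); rewrite -e.
  exact: (hidealMr iJ erefl u (hidealMr iJ erefl (fden y) Jx)).
- by move=> d; apply: (hideal0 iJ).
- by move=> d x y Jx Jy; apply: (hidealD iJ); apply: (hidealMr iJ).
- by move=> i j k e x y Jy; apply: (hidealMl iJ).
- by move=> i j k e x y Jx; apply: (hidealMr iJ).
Qed.

Definition rinv i (s : R i) (ps : ~ p i s) : rloc (- i) :=
  @Frac R p (gregular R) (- i) 0 i gone s ps (addNr i).

Lemma floc_eq_of d (x : rloc d) (b : R d) :
  fnum x = gmul (fdegE x) b (fden x) -> floc_eq x (floc_of p (b : gregular R d)).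
Proof.
move=> e; exists 0, gone; split; first exact: hprime1.
congr (gmul erefl _ gone); rewrite /= e.
have e4 : d + (ddeg x + 0) = ndeg x + 0 by rewrite addrA fdegE.
rewrite (gmulA (fdegE x) erefl (addr0 (ddeg x)) (floc_cross x (floc_of p (b : gregular R d)))).
by rewrite gmul1r.
Qed.

Lemma rloc_to_sat (J : forall d, set (rloc d)) : is_rloc_ideal J ->
  satideal (fun i (x : R i) => J i (floc_of p (x : gregular R i))).
Proof.
move=> rJ; split; first split.
- exact: rloc_ideal0.
- move=> i a b Ja Jb; apply: (rloc_ideal_eq rJ _ (rloc_idealD rJ Ja Jb)).
  apply: floc_eq_of; rewrite /= gmulDl.
  by rewrite !(gmul_m1r _ _ erefl); congr (_ + gmul _ _ _); apply: eq_irrelevance.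
- move=> i j k e a b Jb.
  apply: (rloc_ideal_eq rJ _ (rloc_idealMl rJ e (floc_of p (a : gregular R i)) Jb)).
  apply: floc_eq_of => /=; have e' : k + 0 = i + j by rewrite addr0 e.
  by rewrite (gmul_m1r _ _ e') (gmulA e e' (addr0 j) erefl) gmul1r.
- move=> i j k e a b Ja.
  apply: (rloc_ideal_eq rJ _ (rloc_idealMr rJ e (floc_of p (b : gregular R j)) Ja)).
  apply: floc_eq_of => /=; have e' : k + 0 = i + j by rewrite addr0 e.
  by rewrite (gmul_m1r _ _ e') (gmulA e e' (addr0 j) erefl) gmul1r.
move=> i j k e x s ps Jxs.
have e' : k + - j = i by rewrite -e addrK.
apply: (rloc_ideal_eq rJ _ (rloc_idealMr rJ e' (rinv ps) Jxs)).
apply: floc_eq_of => /=; have e3 : i + j = k + 0 by rewrite addr0.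
by rewrite (gmul_m1l _ _ e3) (gmulA e erefl (addr0 j) e3) gmul1r.
Qed.

(** A fraction and its numerator are unit multiples of each other in R_p, so extension and
    contraction of ideals match the two generated ideals. *)
Lemma rloc_genP (S : set {d : int & rloc d}) d (x : rloc d) :
  rloc_gen S x <->
  sgen (fun a => exists y, S y /\ a = Tagged (fun i => R i) (fnum (tagged y))) (fnum x).
Proof.
split=> [Sx|Sx J rJ SJ].
  apply: (Sx (fun d (x : rloc d) => sgen _ (fnum x))); first exact: rloc_of_sat (sgen_sat _).
  by move=> y Sy J sJ SJ; apply: (SJ (Tagged (fun i => R i) (fnum (tagged y)))); exists y.
have rfrac e (y : rloc e) : J _ (floc_of p (fnum y : gregular R (ndeg y))) <-> J e y.
  have e' : ndeg y + - ddeg y = e by rewrite -fdegE addrK.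
  split=> Jy.
    apply: (rloc_ideal_eq rJ _ (rloc_idealMr rJ e' (rinv (@fdenP _ _ _ _ y)) Jy)).
    exists 0, gone; split; first exact: hprime1.
    congr (gmul erefl _ gone) => /=.
    have e3 : ndeg y + ddeg y = ndeg y + 0 + ddeg y by rewrite addr0.
    by rewrite (gmul_1m _ _ e3) (gmul_m1l _ _ e3).
  apply: (rloc_ideal_eq rJ _ (rloc_idealMr rJ (fdegE y)
           (floc_of p (fden y : gregular R (ddeg y))) Jy)).
  by apply: floc_eq_of => /=; rewrite (gmul_m1r _ _ erefl).
by apply/rfrac; apply: Sx (rloc_to_sat rJ) _ => _ [y [Sy ->]]; apply/rfrac/SJ.
Qed.

Definition rtors i (x : R i) := exists j (u : R j), ~ p j u /\ gmul erefl x u = 0.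

Lemma floc_eq0P d (x : rloc d) : floc_eq x (floc_of p 0) <-> rtors (fnum x).
Proof.
have z j (u : R j) : gmul erefl (gmul (floc_cross x (floc_of p 0)) (0 : R d) (fden x)) u = 0.
  by rewrite gmul0l gmul0l.
split=> -[j [u [pu e]]].
  have e0 : gmul erefl (gmul erefl (fnum x) gone) u = 0 by apply: etrans e (z _ _).
  exists j, u; split=> //.
  have e3 : ndeg x + j = ndeg x + 0 + j by rewrite addr0.
  rewrite (gmul_1m _ _ e3) in e0; move: e0; generalize (ndeg x + 0 + j) e3 => l e4.
  by case: l / e4.
exists j, u; split=> //; apply: etrans (esym (z _ _)) => /=.
have e3 : ndeg x + j = ndeg x + 0 + j by rewrite addr0.
by rewrite (gmul_1m _ _ e3); move: (ndeg x + 0 + j) e3 => l e4; case: l / e4.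
Qed.

Lemma rloc_max_num d (x : rloc d) : rloc_max x -> p _ (fnum x).
Proof.
move=> mx; apply: (mx (fun d (x : rloc d) => p _ (fnum x))).
  apply: rloc_of_sat; split; first exact: hprime_ideal.
  by move=> i j k e y s ps /hprimeM[].
by move=> _ [i [a [pa ->]]].
Qed.

(** Passing to numerators moves the regular sequence into R, with torsion and saturated ideals in
    place of zero and ideals of R_p. *)
Lemma regular_numerators : max_ideal_regular p ->
  exists (n : nat) (a : nat -> {i : int & R i}), let S k b := exists2 j, (j < k)%N & b = a j in
  [/\ forall k, (k < n)%N -> p _ (tagged (a k)),
      forall k, (k < n)%N -> forall i j (e : i + tag (a k) = j) (x : R i),
        rtors (gmul e x (tagged (a k))) -> rtors x,
      forall k, (k < n)%N -> forall i j (e : i + tag (a k) = j) (x : R i),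
        sgen (S k) (gmul e x (tagged (a k))) -> sgen (S k) x
    & forall i (x : R i), p i x -> sgen (S n) x].
Proof.
move=> [n [f [reg gen]]]; exists n.
pose num (y : {d : int & rloc d}) := Tagged (fun i => R i) (fnum (tagged y)).
(* Indexing by [nat] suits the recursion defining [kosz]; from n on the value is 0 in degree 0. *)
exists (fun k => if insub k is Some i then num (f i) else Tagged (fun i => R i) (0 : R 0)) => S.
have aE k (kn : (k < n)%N) :
    (if insub k is Some i then num (f i) else Tagged (fun i => R i) (0 : R 0)) =
    num (f (Ordinal kn)).
  by rewrite insubT.
have SE (k : nat) : (k <= n)%N -> forall b, S k b <->
    exists y, (exists j : 'I_n, (j < k)%N /\ y = f j) /\ b = num y.
  move=> kn b; split=> [[j jk ->]|[_ [[j [jk ->]] ->]]].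
    have jn := leq_trans jk kn; rewrite aE; exists (f (Ordinal jn)); split=> //.
    by exists (Ordinal jn).
  by exists j => //; rewrite aE; congr (num (f _)); apply: val_inj.
have sgenE k d (x : rloc d) : (k <= n)%N -> sgen (S k) (fnum x) <->
    rloc_gen [set y | exists j : 'I_n, (j < k)%N /\ y = f j]%classic x.
  move=> kn; rewrite rloc_genP; split=> Sx J sJ SJ; apply: Sx => // b.
    by move/(SE k kn); apply: SJ.
  by move=> Sb; apply: SJ; apply/(SE k kn).
split.
- move=> k kn; rewrite aE /=; apply: rloc_max_num; rewrite gen => J rJ SJ; apply: SJ.
  by exists (Ordinal kn).
- move=> k kn i j; rewrite aE /= => e x; case: j / e => tx.
  have /= := (reg (Ordinal kn)).1 _ _ erefl (floc_of p (x : gregular R i)).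
  set x1 := floc_of p (x : gregular R i); set y := tagged _ => h.
  exact: (proj1 (floc_eq0P x1) (h (proj2 (floc_eq0P (rloc_mul erefl x1 y)) tx))).
- move=> k kn i j; rewrite aE /= => e x; case: j / e => tx.
  have /= h := (reg (Ordinal kn)).2 _ _ erefl (floc_of p (x : gregular R i)).
  move: h; set x1 := floc_of p (x : gregular R i); set y := tagged _ => h.
  apply: (proj2 (sgenE k _ x1 (ltnW kn))); apply: h.
  exact: (proj1 (sgenE k _ (rloc_mul erefl x1 y) (ltnW kn)) tx).
move=> i x px; apply/(sgenE n _ (floc_of p (x : gregular R i))) => //.
have : rloc_max (floc_of p (x : gregular R i)).
  move=> J rJ SJ; apply: (SJ (Tagged (fun d => rloc d) (floc_of p (x : gregular R i)))).
  by exists i, x.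
rewrite gen => mx J rJ SJ; apply: mx => // _ [j _ <-]; apply: SJ.
by exists j.
Qed.

End RegularSequence.

(** * The Koszul object of a regular sequence is a residue field object *)

Section KoszulUnit.
Variable K : tt_category.
Local Notation one := (@tunit K).
Local Notation R := (central_ring K).
Local Notation H j X := (mor one (sh j X)).

Definition kin i (a : H i one) (X : K) : mor X (koszul a X) := projT1 (cid (koszulP a X)).

Lemma kinP i (a : H i one) X : exists h, dist (lact a X) (kin a X) h.
Proof. by rewrite /kin; case: cid. Qed.

Variable a : nat -> {i : int & R i}.

Fixpoint kosz k (X : K) : K :=
  if k is k'.+1 then koszul (tagged (a k') : H _ one) (kosz k' X) else X.

Fixpoint kunit k : mor one (kosz k one) :=
  if k is k'.+1 return mor one (kosz k one) then kin (tagged (a k') : H _ one) _ \c kunit k'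
  else idm one.

End KoszulUnit.

Section ResidueField.
Variable K : tt_category.
Local Notation one := (@tunit K).
Local Notation R := (central_ring K).
Local Notation H j X := (mor one (sh j X)).
Variables (p : Spec R) (n : nat) (a : nat -> {i : int & R i}).
Let S k b := exists2 j, (j < k)%N & b = a j.

Hypothesis p_a : forall k, (k < n)%N -> p _ (tagged (a k)).
Hypothesis a_reg : forall k, (k < n)%N ->
  forall i j (e : i + tag (a k) = j) (x : R i),
    rtors p (gmul e x (tagged (a k))) -> rtors p x.
Hypothesis a_seq : forall k, (k < n)%N ->
  forall i j (e : i + tag (a k) = j) (x : R i),
    sgen p (S k) (gmul e x (tagged (a k))) -> sgen p (S k) x.
Hypothesis a_gen : forall i (x : R i), p i x -> sgen p (S n) x.
Hypothesis R_even : even_degrees R.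

Lemma ann_satideal C (u : mor one C) :
  satideal p (fun j (r : R j) => ptors p (shm j u \c (r : H j one))).
Proof.
split; first split.
- by move=> i; rewrite compr0; apply: ptors0.
- by move=> i x y tx ty; rewrite ccompDr; apply: ptorsD.
- move=> i j k e x y ty; have e' : j + i = k by rewrite addrC.
  have [c cE] := hact_comm e e' (x : H i one) y.
  by rewrite /= cE hact_nat; apply: ptors_hact.
- by move=> i j k e x y tx; rewrite /= hact_nat; apply: ptors_hact.
move=> i j k e x s ps; rewrite /= hact_nat; exact: ptors_hactK.
Qed.

(* H^*C at p is cyclic, generated by u, with annihilator J. *)
Definition generates C (u : mor one C) (J : forall j, R j -> Prop) :=
  (forall j (m : H j C), exists l (s : H l one) q (e : j + l = q) (r : H q one),
     ~ p l s /\ hact e m s = shm q u \c r) /\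
  (forall j (r : R j), ptors p (shm j u \c (r : H j one)) <-> J j r).

Lemma generates_unit : generates (idm one) (sgen p (fun _ => False)).
Proof.
split=> [j m|j r].
  exists 0, (sh0 one), j, (addr0 j), m; split; first exact: hprime1.
  by rewrite shm_id ccomp_idl hact1.
rewrite shm_id ccomp_idl; split=> [/ptorsP[l [s [ps e]]] J sJ _|Jr].
  by apply: (sJ.2 _ _ _ erefl r _ ps); rewrite /= e; apply: (hideal0 sJ.1).
by have := Jr _ (ann_satideal (idm one)); rewrite shm_id ccomp_idl; apply.
Qed.

(** At p, H^*D is R/J and b is regular on it, so the long exact sequence makes H^* of the cone R/(J,
    b), cyclic on the image of u. *)
Lemma generates_koszul i (b : H i one) D (u : mor one D) (J : forall j, R j -> Prop) :
  generates u J -> (forall j l (e : j + i = l) (x : R j), J l (gmul e x (b : R i)) -> J j x) ->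
  generates (kin b D \c u)
    (fun j r => forall J', satideal p J' -> (forall j x, J j x -> J' j x) -> J' i b -> J' j r).
Proof.
move=> [surj ann] Jreg; have [h d] := kinP b D; move: (kin b D) d => g d.
have reg j l (e : j + i = l) (m : H j D) : hact e m b = 0 -> ptors p m.
  move=> mb; have [l' [s [q [eq [r [ps E]]]]]] := surj j m.
  have e4 : l + l' = q + i by rewrite -e -eq addrAC.
  have [c cE] := hact_swap eq erefl e e4 m s b.
  apply: (ptors_hactK (e := eq) ps); rewrite E; apply/ann.
  apply: (Jreg _ _ erefl); apply/ann.
  by rewrite /= hact_nat -E cE mb hact0l; apply: ptors0.
split=> [j m|j r].
  have [l [s [ps e]]] := dist_lact_tors m reg d.
  have {}e : shm (j + l) h \c hact erefl m s = 0.
    by rewrite hact_nat hact_act e compr0.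
  have [m' E] := shm_dist_lift' d e.
  have [l' [t [q [eq [r [pt E']]]]]] := surj _ m'.
  have el : j + (l + l') = q by rewrite addrA.
  exists (l + l'), (hact erefl s t), q, el, r; split; first by move/hprimeM => [].
  by rewrite -(hactA erefl eq) E -hact_nat E' ccompA -shm_comp.
split=> [|Jr]; last first.
  apply: Jr (ann_satideal (g \c u)) _ _ => [j' x /ann|].
    by rewrite shm_comp -ccompA; apply: ptors_l.
  have -> : shm i (g \c u) \c b = 0; last exact: ptors0.
  rewrite -[X in _ \c X](act_unit b) -act_nat ccompA.
  by rewrite (proj1 (lact_post b g) (dist_comp0 d)) comp0r.
rewrite shm_comp -ccompA => -[l [s [ps e]]] J' sJ' JJ' J'b.
have {}e : shm (j + l) g \c (shm (j + l) u \c hact erefl (r : H j one) s) = 0.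
  by rewrite !hact_nat hact_act e compr0.
have [n0 E] := shm_dist_lift d e.
have e1 : - i + (j + l) = j + l - i by rewrite addrC.
have e2 : j + l - i + i = j + l by rewrite subrK.
have [c cE] := lact_hact b e1 e2; rewrite cE in E.
move: (shD e1 D \c n0) E => m E.
have [l' [t [q [eq [r' [pt E']]]]]] := surj _ m.
have e4 : q + i = j + l + l' by rewrite -eq addrAC subrK.
have [c' cE'] := hact_swap e2 erefl eq e4 m (b \c c) t.
have J'b' : J' i (hact (addr0 i) (b \c c) c').
  have J'bc : J' i (b \c c).
    by rewrite -(hact_id0 (addr0 i) b c); exact: (hidealMr sJ'.1 (addr0 i) (sh0 one \c c) J'b).
  exact: (hidealMr sJ'.1 (addr0 i) c' J'bc).
(* Both r s t and r' (b c) c' send u to the class m (b c) t; their difference is in J, and the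
   second one is in J'. *)
have Jd : J (j + l + l') (hact erefl (hact erefl (r : H j one) s) t
    - hact e4 r' (hact (addr0 i) (b \c c) c')).
  apply/ann; rewrite compBr !hact_nat -hact_nat E cE' E' subrr; exact: ptors0.
apply: (sJ'.2 _ _ _ erefl _ _ ps); apply: (sJ'.2 _ _ _ erefl _ _ pt).
have := hidealD sJ'.1 (JJ' _ _ Jd) (hidealMl sJ'.1 e4 r' J'b').
by rewrite subrK.
Qed.

Lemma generates_kosz k : (k <= n)%N -> generates (kunit a k) (sgen p (S k)).
Proof.
elim: k => [_|k IH kn].
  have [s e] := generates_unit; split=> // j r; rewrite e; split=> Jr J sJ SJ; apply: Jr => //.
  by move=> b [].
have [s e] := generates_koszul (IH (ltnW kn)) (a_seq kn).
split=> // j r; rewrite e; split=> [Jr J sJ SJ|Jr J sJ SJ Ja].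
  apply: (Jr J sJ) => [j' x Sx|]; last by apply: (SJ (a k)); exists k.
  by apply: (Sx J sJ) => b [j0 jk ->]; apply: SJ; exists j0 => //; apply: ltnW.
apply: (Jr J sJ) => b [j0]; rewrite ltnS leq_eqVlt => /orP[/eqP-> ->//|jk ->].
by apply: SJ => J' _; apply; exists j0.
Qed.

Local Notation KK := (kosz a n one).
Local Notation uu := (kunit a n).

Lemma p_satideal : satideal p p.
Proof.
split; first exact: hprime_ideal.
by move=> i j k e y s ps /hprimeM[].
Qed.

(** The saturated ideal generated by the whole sequence is p, because p is itself saturated. *)
Lemma residue_generator : generates uu p.
Proof.
have [s e] := generates_kosz (leqnn n); split=> // j r; rewrite e; split; last exact: a_gen.
by apply; [exact: p_satideal | move=> _ [k kn ->]; apply: p_a].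
Qed.

(** The element [a k] already acts as zero at p on its own tensor factor, by [ptors_kcone]. *)
Lemma ptors_kosz m X k : (k < m)%N -> (m <= n)%N ->
  ptors p (act (tagged (a k) : H _ one) (kosz a m X)).
Proof.
elim: m => // m IH; rewrite ltnS leq_eqVlt => /orP[/eqP->|km] mn /=.
  apply: ptors_act_tensl; apply: ptors_kcone => // j l e x.
  by move=> /ptorsP tx; apply/ptorsP; apply: (a_reg mn tx).
by apply: ptors_act_tensr; apply: IH => //; apply: ltnW.
Qed.

Lemma kosz_thick (C : K -> Prop) m X : thick C -> C X -> C (kosz a m X).
Proof.
move=> tC CX; elim: m => //= m IH; have [g [h d]] := koszulP (tagged (a m) : H _ one) (kosz a m X).
exact: thick_cone d (thick_sh tC _ IH) IH.
Qed.

Lemma kosz_nakayama m X : (forall X : K, noeth X) -> (m <= n)%N ->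
  ~ acyclic p X -> ~ acyclic p (kosz a m X).
Proof.
move=> nK + nX; elim: m => //= m IH mn; apply: nakayama => //; first exact: p_a.
by apply: IH; apply: ltnW.
Qed.

(* The obstruction to extending a map over the next cell of the Koszul object is
   the action of some [a k] on Z, which a denominator kills. *)
Lemma kosz_extend m Z j (z : H j Z) : (m <= n)%N ->
  (forall k, (k < n)%N -> ptors p (act (tagged (a k) : H _ one) Z)) ->
  exists l (s : H l one) q (e : j + l = q) (w : mor (kosz a m one) (sh q Z)),
    ~ p l s /\ w \c kunit a m = hact e z s.
Proof.
move=> + tZ; elim: m => [_|m IH mn] /=.
  exists 0, (sh0 one), j, (addr0 j), z; split; first exact: hprime1.
  by rewrite ccomp_idr hact1.
have [l [s [q [e [w [ps wE]]]]]] := IH (ltnW mn).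
set b : H _ one := tagged (a m); have [h d] := kinP b (kosz a m one).
have [l' [t [pt tE]]] := ptors_act_sh q (tZ m mn).
have [|v vE] := dist_ext (m := act t (sh q Z) \c w) d.
  apply/lact_post; rewrite ccompA act_nat.
  by have [r _ ->] := act_sh t (tag (a m)) (sh q Z); rewrite -(ccompA r) tE compr0 comp0r.
have e2 : j + (l + l') = q + l' by rewrite addrA e.
exists (l + l'), (hact erefl s t), (q + l'), e2, (shD erefl Z \c v).
split; first by move/hprimeM => [].
rewrite -[shD _ _ \c v \c _]ccompA [v \c _]ccompA -vE -(hactA e erefl) -wE hact_act.
by rewrite -!ccompA.
Qed.

End ResidueField.

(** * Retracts of Koszul objects *)

Section Retract.
Variable K : tt_category.
Local Notation one := (@tunit K).
Local Notation R := (central_ring K).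
Local Notation H j X := (mor one (sh j X)).
Variable p : Spec R.
Hypothesis K_gen : forall X : K, thick_gen one X.

(** A map killed by f factors, up to suspension, through the cone Z, whose identity is torsion. *)
Lemma ptors_dist_mono X Y Z (f : mor X Y) (g : mor Y Z) h i W (d : mor W (sh i X)) :
  dist f g h -> ptors p (idm Z) -> shm i f \c d = 0 -> ptors p d.
Proof.
move=> D tZ; have [d0 ->] := shm_fullV (addNr i) d.
rewrite ccompA -shm_comp => /(iso_compr0 (shV_iso _ _))/shm_eq0 fd.
apply: ptors_r; apply/ptors_sh/(ptors_sh _ 1).
have [|m ->] := dist_lift'' (m := Sgm d0) D; first by rewrite -shm_comp fd shm0.
by rewrite -[m]ccomp_idl; apply/ptors_l/ptors_r.
Qed.

Definition img X Y (f : mor X Y) j (m : H j Y) : Prop := exists m', m = shm j f \c m'.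

Lemma img_submod X Y (f : mor X Y) : submod (img f).
Proof.
split=> [i|i _ _ [m ->] [m' ->]|i j k e _ a [m ->]].
- by exists 0; rewrite compr0.
- by exists (m + m'); rewrite ccompDr.
by exists (hact e m a); rewrite hact_nat.
Qed.

(* The cone of f has torsion cohomology, hence a torsion identity. *)
Lemma local_inverse G Y (f : mor G Y) :
  (forall j (m : H j G), ptors p (shm j f \c m) -> ptors p m) ->
  (forall j (m : H j Y), sat p (img f) m) ->
  exists i (t : H i one) j (t' : H j one) (g : mor Y (sh i G)),
    [/\ ~ p i t, ~ p j t' & act t' (sh i G) \c (g \c f) = act t' (sh i G) \c act t G].
Proof.
move=> inj surj; have [Q [y [h d]]] := dist_cone f.
have acQ : acyclic p Q.
  move=> j m; have [l [s [ps e]]] : ptors p (shm j h \c m).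
    apply: (ptors_iso_l (shD_iso erefl G)); apply: inj.
    rewrite ccompA -shD_nat -!ccompA [shm j (Sgm f) \c _]ccompA -shm_comp.
    by rewrite (dist_Sg_comp0 d) shm0 comp0r compr0; apply: ptors0.
  have {}e : shm (j + l) h \c hact erefl m s = 0.
    by rewrite hact_nat hact_act e compr0.
  have [m' E] := shm_dist_lift' d e.
  have [l' [t [pt [m'' E']]]] := surj _ m'.
  apply: (ptors_hactK (e := erefl) ps); rewrite E; apply: (ptors_hactK (e := erefl) pt).
  rewrite -hact_nat E' ccompA -shm_comp (dist_comp0 d) shm0 comp0r; exact: ptors0.
have tQ := acyclic_id (K_gen Q) acQ.
have [i [t [pt]]] := tQ; rewrite ccomp_idr => tQ0.
(* As t kills the cone, its action on Y factors through f; then g f and t differ by a map that f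
   kills, hence by torsion. *)
have [|g gE] := shm_dist_lift (j := i) (m := act t Y) d.
  by rewrite -act_nat tQ0 comp0r.
have [|j [t' [pt' e]]] := ptors_dist_mono (d := g \c f - act t G) d tQ.
  by rewrite compBr ccompA -gE act_nat subrr.
exists i, t, j, t', g; split=> //.
by apply/eqP; rewrite -subr_eq0 -compBr e.
Qed.

Variables (KK : K) (u : mor one KK).
Hypothesis u_gen : generates p u p.

Variable Y : K.
Hypothesis Y_ext : forall j (z : H j Y),
  exists l (s : H l one) q (e : j + l = q) (w : mor KK (sh q Y)), ~ p l s /\ w \c u = hact e z s.

Lemma residue_map j (z : H j Y) : exists q (f : mor (sh q KK) Y),
  (exists l (s : H l one) k (e : j + l = k), ~ p l s /\ img f (hact e z s)) /\
  forall i (m : H i (sh q KK)), ptors p m \/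
    exists l (t : H l one) l' (s : H l' one) k (e : i + l = k) (e' : j + l' = k),
      [/\ ~ p l t, ~ p l' s & hact e (shm i f \c m) t = hact e' z s].
Proof.
have [l [s [q [e [w [ps wE]]]]]] := Y_ext z.
have [f fE] := shm_fullV (addNr q) w.
(* The generator u, seen in degree q of Sigma^(-q) KK; f sends it to z s. *)
set v := shV (addNr q) KK \c u.
have fv : shm q f \c v = hact e z s by rewrite /v ccompA -fE.
exists (- q), f; split; first by exists l, s, q, e; split=> //; exists v.
move=> i m.
have [l' [t [k [e1 [r [pt tE]]]]]] := u_gen.1 _ (shD erefl KK \c m).
have e2 : i + l' = k + q by lia.
have e3 : q + k = k + q by rewrite addrC.
have e4 : - q + (k + q) = k by rewrite addrC addrK.
have mt : hact e2 m t = hact e3 v r.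
  apply: (iso_monic (shD_iso e4 KK)).
  rewrite -(hact_shD erefl e1) -(hact_shD (addNr q) (add0r k)) tE.
  rewrite /v ccompA isoKVl; last exact: shD_iso.
  by rewrite /hact shm_comp -ccompA ccompA shD0l ccomp_idl.
(* At p the class m is v r: torsion if r is in p, and otherwise sent by f to z times s r, with s r
   outside p. *)
case: (pselect (p k r)) => pr; [left|right].
  apply: (ptors_iso_l (shD_iso erefl KK)); apply: (ptors_hactK (e := e1) pt).
  by rewrite tE; apply/(u_gen.2 k).
exists l', t, (l + k), (hact erefl s r), (k + q), e2.
have e5 : j + (l + k) = k + q by rewrite addrA e.
exists e5; split=> //; first by move/hprimeM => [].
by rewrite -hact_nat mt hact_nat fv (hactA e e3 erefl e5).
Qed.

(* A maximal finite sum of suspensions of KK that embeds locally into Y is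
   locally all of Y, as the localized cohomology of KK is a residue field. *)
Lemma residue_retract : noeth Y -> ~ acyclic p Y ->
  exists q (al : mor (sh q KK) Y) i (t : H i one) j (t' : H j one)
      (be : mor Y (sh j (sh i (sh q KK)))),
    [/\ ~ p i t, ~ p j t' &
      be \c al = act t' (sh i (sh q KK)) \c act t (sh q KK)].
Proof.
move=> nY nac.
have [j0 [z0 nz0]] : exists j (z : H j Y), ~ ptors p z.
  apply: contrapT => nz; apply: nac => j m; apply: contrapT => nm; apply: nz.
  by exists j, m.
have [q0 [f0 [_ f0E]]] := residue_map z0; set L := sh q0 KK in f0 f0E *.
(* The data are a map from G to Y, required to be injective at p, and maps that make L a retract of
   G. *)
pose T := {G : K & (mor G Y * mor L G * mor G L)%type}.
pose phi (t : T) : mor (tag t) Y := (tagged t).1.1.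
pose Q (t : T) := (tagged t).2 \c (tagged t).1.2 = idm L /\
  forall j (m : H j (tag t)), ptors p (shm j (phi t) \c m) -> ptors p m.
pose t0 : T := Tagged (fun G => (mor G Y * mor L G * mor G L)%type) (f0, idm L, idm L).
have Q0 : Q t0.
  split=> [|i m tm]; first exact: ccomp_idl.
  have [//|[l [t [l' [s [k [e [e' [pt ps E]]]]]]]]] := f0E i m.
  by case: nz0; apply: (ptors_hactK (e := e') ps); rewrite -E; apply: ptors_hact.
have [[G [[f g] r]] [[/= rg inj] max]] := acc_max (N := fun t => sat p (img (phi t)))
  nY (fun t _ => sat_submod p (img_submod (phi t))) Q0.
rewrite /phi /= in inj max.
have surj j (z : H j Y) : sat p (img f) z.
  apply: contrapT => nz; have [q [fz [[l [s [k [e [ps fzs]]]]] fzE]]] := residue_map z.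
  have [W [i1 [i2 [p1 [p2 [e11 e22 e21 e12 eW]]]]]] := biproduct_ex G (sh q KK).
  pose f' := f \c p1 + fz \c p2.
  have f'1 : f' \c i1 = f.
    by rewrite /f' ccompDl -!ccompA e11 e21 compr0 addr0 ccomp_idr.
  have f'2 : f' \c i2 = fz.
    by rewrite /f' ccompDl -!ccompA e12 e22 compr0 add0r ccomp_idr.
  apply: (nz).
  apply: (max (Tagged (fun G => (mor G Y * mor L G * mor G L)%type) (f', i1 \c g, r \c p1))) => /=.
  - split=> /= [|i m tm]; first by rewrite -ccompA (ccompA p1) e11 ccomp_idl.
    have mE : m = shm i i1 \c (shm i p1 \c m) + shm i i2 \c (shm i p2 \c m).
      by rewrite !ccompA -!shm_comp -ccompDl -shm_add eW shm_id ccomp_idl.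
    have fE : shm i f' \c m = shm i f \c (shm i p1 \c m) + shm i fz \c (shm i p2 \c m).
      by rewrite !ccompA -!shm_comp -ccompDl -shm_add.
    (* If the component in the new summand is torsion, so is the other one; if not, z lies in the
       image of f at p, against its choice. *)
    have [t2|[l1 [t [l2 [s2 [k2 [e2 [e3 [pt ps2 E]]]]]]]]] := fzE i (shm i p2 \c m).
      rewrite mE; apply: ptorsD; apply: ptors_l => //; apply: inj.
      rewrite -[X in ptors _ X](addrK (shm i fz \c (shm i p2 \c m))) -fE.
      by apply: ptorsB => //; apply: ptors_l.
    have [l3 [t1 [pt1 t1E]]] := (proj1 (ptorsP _ _)) tm.
    have [c cE] := hact_comm erefl (addrC l1 l3) t1 t.
    set b := hact (addr0 l3) t1 c in cE.
    have pb : ~ p l3 b.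
      move=> pb; have /hprimeM[] // : p (l3 + l1) (gmul erefl (t1 : R l3) (t : R l1)).
      by rewrite /= cE; exact: (hidealMl (hprime_ideal p) (addrC l1 l3) t pb).
    have e4 : i + (l3 + l1) = k2 + l3 by rewrite -e2 -addrA [l1 + l3]addrC.
    have e5 : j + (l2 + l3) = k2 + l3 by rewrite addrA e3.
    exfalso; apply: nz; apply: (sat_den (e := e5) (s := hact erefl s2 b)).
      by move/hprimeM => [].
    exists (- hact e4 (shm i p1 \c m) (hact erefl t1 t)).
    rewrite compNr hact_nat -(hactA e3 erefl) -E (hactA e2 erefl (addrC l1 l3) e4) -cE.
    apply/eqP; rewrite -addr_eq0 [X in X == _]addrC -hactDl -fE.
    have e6 : i + l3 + l1 = k2 + l3 by rewrite -e4 addrA.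
    by rewrite -(hactA erefl e6) t1E hact0l.
  - move=> i x [l1 [s1 [ps1 [m mE]]]]; exists l1, s1; split=> //.
    by exists (shm _ i1 \c m); rewrite ccompA -shm_comp f'1.
  apply: (sat_den (e := e) ps); case: fzs => m ->.
  by exists (shm _ i2 \c m); rewrite ccompA -shm_comp f'2.
have [i [t [j [t' [b [pt pt' E]]]]]] := local_inverse inj surj.
exists q0, (f \c g), i, t, j, t', (shm j (shm i r) \c (act t' (sh i G) \c b)); split=> //.
rewrite -!ccompA [b \c _]ccompA [act t' _ \c (_ \c g)]ccompA E.
rewrite !ccompA -act_nat -!ccompA; congr (_ \c _).
by rewrite ccompA -act_nat -ccompA rg ccomp_idr.
Qed.

End Retract.

(** * The classification *)

Section Annihilator.
Variable K : tt_category.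
Implicit Types A B W X Y Z : K.
Local Notation one := (@tunit K).
Local Notation R := (central_ring K).
Local Notation H j X := (mor one (sh j X)).

Definition ann W i (r : R i) : Prop := act (r : H i one) W = 0.

Lemma ann_hideal W : is_hideal (ann W).
Proof.
split; rewrite /ann.
- by move=> i; apply: act0.
- by move=> i a b a0 b0; rewrite actD a0 b0 addr0.
- by move=> i j k e a b b0; have [q _ ->] := act_mul e (a : H i one) b W; rewrite b0 !compr0.
- move=> i j k e a b a0; have [q _ ->] := act_mul e (a : H i one) b W.
  by rewrite a0 shm0 comp0r compr0.
Qed.

Lemma ann_koszul i (a : H i one) W j (r : R j) : ann W r -> ann (koszul a W) r.
Proof. exact: act_tensr. Qed.

Lemma ann_acyclic (q : Spec R) i (s : R i) W : ~ q i s -> ann W s -> acyclic q W.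
Proof.
move=> qs s0 j m; exists i, s; split=> //; have [r ir rE] := act_sh (s : H i one) j W.
have {}s0 : act (s : H i one) W = 0 by [].
rewrite (_ : act _ _ = 0) ?comp0r //.
by apply: (iso_compl0 ir); rewrite -rE s0 shm0.
Qed.

(* For such a W, if [koszul r W] is bad too then r^2 kills W: it kills
   [koszul r W], which is also killed by the annihilator of W. *)
Definition max_ann (Bad : K -> Prop) W :=
  Bad W /\ forall W', Bad W' -> (forall i (r : R i), ann W r -> ann W' r) ->
    forall i (r : R i), ann W' r -> ann W r.

Lemma max_ann_ex (Bad : K -> Prop) W0 : hnoetherian R -> Bad W0 -> exists W, max_ann Bad W.
Proof.
move=> nR B0; apply: (acc_max (N := ann) (ok := @is_hideal R)) B0 => [N hN leN|W _].
  have [k kP] := nR N hN (fun n i x => @leN n i x).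
  by exists k => m km i x; rewrite (kP m km).
exact: ann_hideal.
Qed.

End Annihilator.

(** * Koszul objects modulo a thick subcategory *)

Section Quotient.
Variable K : tt_category.
Implicit Types A B W X Y Z : K.
Local Notation one := (@tunit K).
Local Notation R := (central_ring K).
Local Notation H j X := (mor one (sh j X)).
Variable C : K -> Prop.
Hypothesis tC : thick C.

Lemma cone_in_act_sh i (r : H i one) j A : cone_in C (act r (sh j A)) <-> cone_in C (act r A).
Proof.
have [q iq qE] := act_sh r j A.
by rewrite -(cone_in_sh tC j (act r A)) qE (cone_in_compl _ _ iq).
Qed.

Lemma cone_in_act_iso i (r : H i one) A B :
  isomorphic A B -> cone_in C (act r A) -> cone_in C (act r B).
Proof.
move=> [f fi]; apply: (cone_in_iso fi (shm_iso i fi)).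
by rewrite act_nat.
Qed.

Lemma cone_in_act_tens i (r : H i one) A B :
  cone_in C (tensm (act r A) (idm B)) <-> cone_in C (act r (tens A B)).
Proof.
have [q [s [iq js ->]]] := act_tens r A B.
by rewrite (cone_in_compl _ _ iq) (cone_in_compr _ _ js).
Qed.

Lemma koszul_cone i (r : H i one) W : C (koszul r W) <-> cone_in C (act r W).
Proof.
have [g [h d]] := koszulP r W.
rewrite -(cone_in_act_sh r (- i)) -(cone_in_compl _ _ (unsh_iso i W)) -lactE.
by split=> [CZ|]; [exists (koszul r W), g, h | apply: cone_inP d].
Qed.

Lemma koszul_mul i j k (e : i + j = k) (r : H i one) (s : H j one) W :
  C (koszul r W) -> C (koszul s W) -> C (koszul (hact e r s) W).
Proof.
rewrite !koszul_cone => Cr Cs; have [q iq ->] := act_mul e r s W.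
apply/(cone_in_compl _ _ iq); apply: cone_in_comp => //; exact/cone_in_sh.
Qed.

(** The action of r is the zero map, which factors through a zero object; [thick_of_factor]
    applies. *)
Lemma koszul_ann i (r : H i one) W : act r W = 0 -> C (koszul r W) -> C W.
Proof.
move=> r0; rewrite koszul_cone r0; have [O zO] := zero_ex K.
have -> : 0 = (0 : mor O (sh i W)) \c (0 : mor W O) by rewrite comp0r.
apply: thick_of_factor => //; exact: thick_zero.
Qed.

Lemma thick_tensor B W : thick_gen one W -> C B -> C (tens B W).
Proof.
move=> gW CB; apply: (gW (fun W => C (tens B W))); last first.
  by apply: thick_iso CB => //; apply: isomorphic_sym; exists (trunit B); apply: trunit_iso.
split.
- by move=> Z zZ; apply: thick_zero => //; rewrite /is_zero -tensm_id zZ tensm0r.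
- move=> n Z CZ; apply: (thick_iso tC) (thick_sh tC n CZ).
  by apply: isomorphic_sym; exists (tsh n B Z); apply: tsh_iso.
- by move=> X Y Z f g h d; apply: thick_cone tC _ _ _ _ _ _ (tens_exactr B d).
- move=> X Y Z [i1 [i2 [p1 [p2 [e _ _ _ _]]]]].
  apply: (thick_retract tC (i := tensm (idm B) i1) (r := tensm (idm B) p1)).
  by rewrite -tensm_comp ccomp_idl e tensm_id.
Qed.

End Quotient.

Section Classification.
Variable K : tt_category.
Implicit Types A B W X Y Z : K.
Local Notation one := (@tunit K).
Local Notation R := (central_ring K).
Local Notation H j X := (mor one (sh j X)).
Hypothesis K_gen : forall X : K, thick_gen one X.
Hypothesis R_noeth : hnoetherian R.

Lemma spec_acyclic (p q : Spec R) X : spec_le p q -> acyclic q X -> acyclic p X.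
Proof.
by move=> pq aq j m; have [i [s [qs e]]] := aq j m; exists i, s; split=> // /pq.
Qed.


Lemma exact_support (p : Spec R) : exists X, ~ acyclic p X /\
  forall q, ~ acyclic q X -> spec_le p q.
Proof.
have np1 : ~ acyclic p one.
  move=> /(_ 0 (sh0 one))[i [s [ps]]]; rewrite act_nat act_unit => s0.
  apply: ps; suff -> : s = 0 by apply: (hideal0 (hprime_ideal p)).
  by apply: (iso_compl0 (shm_iso i (sh0_iso one))).
have [W [nW max]] := max_ann_ex (Bad := fun W => ~ acyclic p W) R_noeth np1.
(* For r in p, Nakayama keeps p in the support of [koszul r W], so r^2 kills W and r lies in every
   prime of the support of W. *)
exists W; split=> // q nq i r pr; apply: contrapT => qr; apply: nq.
apply: (ann_acyclic (s := hact erefl (r : H i one) r)); first by move=> /hprimeM[].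
apply: (max (koszul (r : H i one) W)).
- by apply: nakayama => //; apply: noeth_all.
- by move=> j s; apply: ann_koszul.
- exact: koszul_sq.
Qed.

Section Thick.
Variables (C : K -> Prop) (tC : thick C).

Definition bad W := ~ C W /\
  forall p : Spec R, ~ acyclic p W -> exists Y, C Y /\ ~ acyclic p Y.

Lemma bad_koszul i (r : H i one) W : bad W -> ~ C (koszul r W) -> bad (koszul r W).
Proof.
move=> [_ sW] nC; split=> // p np; apply: sW => aW; apply: np.
have [g [h d]] := koszulP r W; have tp := acyclic_thick p.
exact: thick_cone d (thick_sh tp _ aW) aW.
Qed.

Variable W : K.
Hypothesis W_max : max_ann bad W.

Definition bad_ideal i (r : R i) : Prop := ~ C (koszul (r : H i one) W).

Lemma bad_ideal_sq i (r : R i) : bad_ideal r -> ann W (gmul erefl r r).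
Proof.
move=> nC; apply: (W_max.2 _ (bad_koszul W_max.1 nC)).
  by move=> j s; apply: ann_koszul.
exact: koszul_sq.
Qed.

Lemma bad_ideal_ann i (r : R i) : ann W r -> bad_ideal r.
Proof. by move=> r0 Cr; apply: W_max.1.1; apply: koszul_ann r0 Cr. Qed.

Lemma bad_idealM i j k (e : i + j = k) (a : R i) (b : R j) :
  bad_ideal (gmul e a b) -> bad_ideal a \/ bad_ideal b.
Proof.
move=> nab; apply: contrapT => /not_orP[/contrapT Ca /contrapT Cb].
by apply: nab; apply: koszul_mul.
Qed.

Lemma bad_ideal_rad i (r : R i) : ann W (gmul erefl r r) -> bad_ideal r.
Proof. by move=> /bad_ideal_ann/bad_idealM[]. Qed.

(** Up to commutation, (a b)^2 is a right multiple of a^2, which kills W. *)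
Lemma bad_idealMr i j k (e : i + j = k) (a : R i) (b : R j) :
  bad_ideal a -> bad_ideal (gmul e a b).
Proof.
move=> /bad_ideal_sq aa; apply: bad_ideal_rad.
have hW := ann_hideal W; set z := gmul e a b.
have e1 : k + i + j = k + k by rewrite -addrA e.
have -> : gmul erefl z z = gmul e1 (gmul erefl z a) b.
  by rewrite (gmulA erefl e1 e erefl).
apply: (hidealMr hW e1); have e2 : i + i + j = k + i by rewrite -e addrAC.
have [c cE] := hact_swap e erefl erefl e2 (a : H i one) b a.
have -> : gmul erefl z a = gmul e2 (gmul erefl a a) (gmul (addr0 j) b (c : R 0)) by [].
exact: (hidealMr hW e2).
Qed.

Lemma bad_hideal : is_hideal bad_ideal.
Proof.
have hW := ann_hideal W; split.
- by move=> i; apply/bad_ideal_ann/(hideal0 hW).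
- move=> i a b Pa Pb.
  have hD i' (x y : R i') : ann W x -> ann W y -> ann W (x + y) by apply: (hidealD hW).
  have [c cE] := hact_comm erefl erefl (b : H i one) a.
  (* Here (a + b)^2 = x + q with q = a d, and both x and q^2 kill W. Hence (a + b)^4 kills W, and
     primality extracts a + b. *)
  pose d := b + gmul (addr0 i) b (c : R 0).
  pose x := gmul erefl a a + gmul erefl b b; pose q := gmul erefl a d.
  have yE : gmul erefl (a + b) (a + b) = x + q.
    rewrite gmulDl !gmulDr /q /d gmulDr /x -!addrA; congr (_ + _).
    have -> : gmul erefl b a = gmul erefl a (gmul (addr0 i) b (c : R 0)) by [].
    by rewrite [RHS]addrCA; congr (_ + _); rewrite [RHS]addrC -?addrA addrC.
  have hx : ann W x by apply: hD; apply: bad_ideal_sq.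
  have hq : ann W (gmul erefl q q) by apply/bad_ideal_sq/bad_idealMr.
  suff : bad_ideal (gmul erefl (a + b) (a + b)) by move=> /bad_idealM[].
  rewrite yE; move: x q hx hq {yE} => x q hx hq.
  apply: bad_ideal_rad; rewrite gmulDl !gmulDr.
  apply: (hD _ _ _ (hD _ _ _ _ _) (hD _ _ _ _ hq)).
  - exact: (hidealMr hW erefl x hx).
  - exact: (hidealMr hW erefl q hx).
  - exact: (hidealMl hW erefl q hx).
- move=> i j k e a b Pb; have e' : j + i = k by rewrite addrC.
  have [c cE] := hact_comm e e' (a : H i one) b.
  have -> : gmul e a b = gmul e' b (gmul (addr0 i) a (c : R 0)) by [].
  exact: bad_idealMr.
- by move=> i j k e a b; apply: bad_idealMr.
Qed.

Lemma bad_ideal1 : ~ bad_ideal (gone : R 0).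
Proof.
move=> /bad_ideal_sq; rewrite /ann /= hact1 => a0; apply: W_max.1.1; apply: thick_zero => //.
apply: (iso_compl0 (act_gone W)); by rewrite a0 comp0r.
Qed.

Definition bad_prime : Spec R := HPrime bad_hideal bad_ideal1 bad_idealM.

(** If W were acyclic, some s outside the prime would kill W, but elements killing W lie in the
    prime. *)
Lemma bad_prime_support : ~ acyclic bad_prime W.
Proof.
move=> /(acyclic_id (K_gen W))[i [s [ns]]]; rewrite ccomp_idr => s0.
by apply: ns; apply: bad_ideal_ann.
Qed.

Section Koszul.
Variables (n : nat) (a : nat -> {i : int & R i}).
Hypothesis a_bad : forall k, (k < n)%N -> bad_ideal (tagged (a k)).

Lemma ann_kosz k i (r : R i) : ann W r -> ann (kosz a k W) r.
Proof. by elim: k => // k IH /IH; apply: ann_koszul. Qed.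

(** If adjoining [a k] led into C, so would adjoining its square; as the square acts as zero, the
    previous Koszul object would be in C. *)
Lemma bad_kosz k : (k <= n)%N -> bad (kosz a k W).
Proof.
elim: k => [_|k IH kn] /=; first exact: W_max.1.
have Bk := IH (ltnW kn); apply: bad_koszul => // Ca; apply: Bk.1.
apply: koszul_ann (koszul_mul tC erefl Ca Ca) => //.
exact/ann_kosz/bad_ideal_sq/a_bad.
Qed.

(** Otherwise this object would be bad with an annihilator containing that of W and s^2; by
    maximality s^2 would kill W. *)
Lemma good_kosz i (s : R i) : ~ bad_ideal s -> C (koszul (s : H i one) (kosz a n W)).
Proof.
move=> gs; apply: contrapT => nC; apply: gs; apply: bad_ideal_rad.
apply: (W_max.2 _ (bad_koszul (bad_kosz (leqnn n)) nC)); last exact: koszul_sq.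
by move=> j r /(ann_kosz n); apply: ann_koszul.
Qed.

Lemma kosz_tensor k : isomorphic (tens (kosz a k one) W) (kosz a k W).
Proof.
elim: k => [|k [f fi]] /=; first by exists (lun W); apply: lun_iso.
exists (tensm (idm _) f \c tassoc (kcone (tagged (a k) : H _ one)) (kosz a k one) W).
exact: iso_comp (tensm_iso (iso_id _) fi) (tassoc_iso _ _ _).
Qed.

End Koszul.

End Thick.

Theorem thick_determined (C : K -> Prop) X : even_degrees R ->
  (forall p : Spec R, max_ideal_regular p) -> thick C ->
  (forall p : Spec R, ~ acyclic p X -> exists Y, C Y /\ ~ acyclic p Y) -> C X.
Proof.
move=> ev reg tC sX; apply: contrapT => nCX.
have [W W_max] := max_ann_ex (Bad := bad C) R_noeth (conj nCX sX).
pose p := bad_prime tC W_max.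
have [Y [CY nY]] := W_max.1.2 p (bad_prime_support (W_max := W_max)).
have [n [a [pa areg aseq agen]]] := regular_numerators (reg p).
have nK : forall X : K, noeth X by apply: noeth_all.
set KK := kosz a n one; set Y' := kosz a n Y.
have [q [al [i [t [j [t' [be [pt pt' E]]]]]]]] :=
  residue_retract K_gen (residue_generator pa aseq agen)
    (fun j z => kosz_extend z (leqnn n) (fun k kn => ptors_kosz areg ev Y kn (leqnn n)))
    (nK Y') (kosz_nakayama pa nK (leqnn n) nY).
have a_bad k : (k < n)%N -> bad_ideal C W (tagged (a k)) := pa k.
have good l (s : H l one) : ~ p l s -> cone_in C (act s (kosz a n W)).
  by move=> ps; apply/(koszul_cone tC)/(good_kosz tC W_max a_bad ps).
pose L := sh q KK.
have LW : isomorphic (sh q (kosz a n W)) (tens L W).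
  apply: isomorphic_sym; apply: (isomorphic_trans (Y := sh q (tens KK W))).
    by exists (lsh q KK W); apply: lsh_iso.
  exact/sh_isomorphic/kosz_tensor.
have goodL l (s : H l one) : ~ p l s -> cone_in C (act s (tens L W)).
  by move=> ps; apply: cone_in_act_iso LW _; apply/(cone_in_act_sh tC)/good.
suff CLW : C (tens L W).
  apply: (bad_kosz tC W_max a_bad (leqnn n)).1; apply: (thick_unsh tC (n := q)).
  exact: (thick_iso tC (isomorphic_sym LW) CLW).
(* The composite L -> Y' -> Sigma L of [residue_retract], up to the degree of the suspension, is
   tensored with W: the middle is in C, and t, t' outside p make the cone lie in C. *)
apply: (thick_of_factor tC (a := tensm al (idm W)) (b := tensm be (idm W))).
  by apply: thick_tensor => //; apply: kosz_thick.
have -> : tensm be (idm W) \c tensm al (idm W) =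
    tensm (act t' (sh i L)) (idm W) \c tensm (act t L) (idm W).
  by rewrite -!tensm_comp E.
apply: cone_in_comp => //; apply/cone_in_act_tens; first exact: goodL.
apply: (cone_in_act_iso (A := sh i (tens L W))).
  by apply: isomorphic_sym; exists (lsh i L W); apply: lsh_iso.
exact/(cone_in_act_sh tC)/goodL.
Qed.

End Classification.

Theorem corollary1p2 (K : tt_category)
    (K_small : essentially_small K)
    (K_gen : forall X : K, thick_gen tunit X)
    (R_noeth : hnoetherian (central_ring K))
    (R_even : even_degrees (central_ring K))
    (R_reg : forall p : Spec (central_ring K), max_ideal_regular p) :
  (* the two maps are well defined, *)
  (forall C : K -> Prop, thick C -> specialization_closed (supp_of C)) /\
  (forall V : set (Spec (central_ring K)),
     specialization_closed V -> thick (subcat_of V)) /\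
  (* mutually inverse, *)
  (forall C : K -> Prop, thick C -> subcat_of (supp_of C) = C) /\
  (forall V : set (Spec (central_ring K)),
     specialization_closed V -> supp_of (subcat_of V) = V) /\
  (* and inclusion preserving in both directions *)
  (forall C D : K -> Prop, thick C -> thick D ->
     (forall X, C X -> D X) <-> (supp_of C `<=` supp_of D)%classic).
Proof.
(* This exhibits [subcat_of V] as the intersection of the thick subcategories of acyclics at the
   primes outside V. *)
have subcatP (V : set (Spec (central_ring K))) X :
    subcat_of V X <-> forall p, ~ V p -> acyclic p X.
  split=> [sX p nV|aX p /acyclicP np]; apply: contrapT => h.
    by apply/nV/sX/acyclicP.
  exact/np/aX.
have mono (C D : K -> Prop) : (forall X, C X -> D X) -> (supp_of C `<=` supp_of D)%classic.
  by move=> CD p [X [CX pX]]; exists X; split=> //; apply: CD.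
have subcatK (C : K -> Prop) : thick C -> subcat_of (supp_of C) = C.
  move=> tC; apply/funext => X; apply/propext; split=> [sX|CX p pX]; last by exists X.
  apply: thick_determined => // p /acyclicP/sX[Y [CY pY]].
  by exists Y; split=> //; apply/acyclicP.
split=> [C tC p q [X [CX pX]] pq|].
  exists X; split=> //; apply/acyclicP => aq.
  by move/acyclicP: pX; apply; apply: spec_acyclic pq aq.
split=> [V Vsp|].
  split.
  - by move=> X zX; apply/subcatP => p nV; apply: thick_zero (acyclic_thick p) _ zX.
  - move=> n X /subcatP sX; apply/subcatP => p nV.
    by apply: thick_sh (acyclic_thick p) _ _ _; apply: sX.
  - move=> X Y Z f g h d /subcatP sX /subcatP sY; apply/subcatP => p nV.
    by apply: thick_cone (acyclic_thick p) _ _ _ _ _ _ d _ _; [apply: sX | apply: sY].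
  - move=> X Y Z b /subcatP sZ; apply/subcatP => p nV.
    by apply: thick_summand (acyclic_thick p) _ _ _ b _; apply: sZ.
split=> //; split=> [V Vsp|C D tC tD].
  apply/seteqP; split=> [p [X [sX pX]]|p Vp]; first exact: sX.
  have [X [nX sX]] := exact_support K_gen R_noeth p.
  exists X; split; last exact/acyclicP.
  by move=> q /acyclicP nq; apply: Vsp Vp (sX q nq).
split; first exact: mono.
move=> CD X CX; rewrite -(subcatK D tD) => p pX.
by apply: CD; exists X.
Qed.
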